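(* The face lattice of any simple polytope is Hamiltonian. That is, for every simple polytope $P$, the cover graph of the face lattice $\mathcal{L}(P)$ has a Hamilton cycle.
   Context: A polytope is the convex hull of finitely many points in some Euclidean space. A $d$-dimensional polytope is simple if each of its vertices is contained in exactly $d$ facets (faces of dimension $d-1$); equivalently, its dual (polar) polytope is simplicial, i.e. all facets of the dual are simplices. The face lattice $\mathcal{L}(P)$ of a polytope $P$ is the set of all faces of $P$, including the empty face $\emptyset$ and $P$ itself, ordered by inclusion. For a poset $(\mathcal{P},<)$, a cover relation is a pair $x,y\in\mathcal{P}$ with $x<y$ such that there is no $z\in\mathcal{P}$ with $x<z<y$; the cover graph of $\mathcal{P}$ is the undirected graph whose vertices are the elements of $\mathcal{P}$ and whose edges are the cover relations of $\mathcal{P}$. A Hamilton cycle of a graph is a cycle that visits every vertex exactly once. *)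

(* Defs.v *)
From HB Require Import structures.
From mathcomp Require Import all_boot all_order all_algebra.
From mathcomp Require Import boolp classical_sets functions cardinality reals.

Set Implicit Arguments.
Unset Strict Implicit.
Unset Printing Implicit Defensive.

Import Order.TTheory GRing.Theory Num.Theory.

Local Open Scope classical_set_scope.
Local Open Scope card_scope.
Local Open Scope ring_scope.

Definition covers d (T : porderType d) (x y : T) : Prop :=
  (x < y)%O /\ ~ exists z : T, (x < z)%O /\ (z < y)%O.

Definition cover_graph d (T : porderType d) : rel T :=
  fun x y => `[< covers x y \/ covers y x >].
Arguments cover_graph {d} T.

(* In a simple graph a cycle has at least three vertices; the bound rules out
   the sequence [:: x; y] that runs along a single edge and back. *)
Definition hamilton_cycle (V : eqType) (e : rel V) (c : seq V) : Prop :=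
  [/\ (3 <= size c)%N, ucycle e c & forall v : V, v \in c].

Definition hamiltonian (V : eqType) (e : rel V) : Prop :=
  exists c : seq V, hamilton_cycle e c.

Section Polytopes.
Variables (R : realType) (n : nat).
Implicit Types (P F A : set 'rV[R]_n) (d : nat).

Definition conv_hull m (p : 'I_m -> 'rV[R]_n) : set 'rV[R]_n :=
  [set x | exists a : 'I_m -> R,
     [/\ forall i, 0 <= a i, \sum_i a i = 1 & x = \sum_i a i *: p i]].

Definition is_polytope P : Prop :=
  exists (m : nat) (p : 'I_m -> 'rV[R]_n), P = conv_hull p.

Definition affine_hull A : set 'rV[R]_n :=
  [set x | exists (m : nat) (p : 'I_m -> 'rV[R]_n) (a : 'I_m -> R),
     [/\ forall i, A (p i), \sum_i a i = 1 & x = \sum_i a i *: p i]].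

(* The empty set, of dimension -1 by convention, has no dimension here. *)
Definition has_dim A d : Prop :=
  exists (x : 'rV[R]_n) (U : {vspace 'rV[R]_n}),
    \dim U = d /\ affine_hull A = [set x + u | u in [set` U]].

(* Faces are cut out by valid inequalities [x *m c <= b]; c = 0 gives P itself
   (b = 0) and the empty face (b = 1). *)
Definition is_face P F : Prop :=
  exists (c : 'cV[R]_n) (b : R),
    (forall x, P x -> (x *m c) 0 0 <= b) /\
    F = [set x | P x /\ (x *m c) 0 0 = b].

Definition is_vertex P (v : 'rV[R]_n) : Prop := is_face P [set v].

Definition is_facet P F : Prop :=
  is_face P F /\ exists d, has_dim P d.+1 /\ has_dim F d.

Definition simple_polytope d P : Prop :=
  [/\ is_polytope P, has_dim P d &
      forall v, is_vertex P v -> [set F | is_facet P F /\ F v] #= `I_d].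

Record face_lattice P : Type := Face {
  face_set :> set 'rV[R]_n;
  face_setP : `[< is_face P face_set >]
}.

HB.instance Definition _ P := [isSub for @face_set P].
HB.instance Definition _ P := [Choice of face_lattice P by <:].
HB.instance Definition _ P :=
  [SubChoice_isSubPOrder of face_lattice P by <: with set_display].

End Polytopes.

Lemma face_lattice_leE (R : realType) (n : nat) (P : set 'rV[R]_n)
  (F G : face_lattice P) : (F <= G)%O = (val F `<=` val G) :> Prop.
Proof. by rewrite -subsetEset. Qed.

(* Main.v *)
Require Import Defs.
From mathcomp Require Import all_boot all_order all_algebra.

(** In a simple polytope of dimension [d] the faces through a vertex correspond
    to the subsets of the [d] facets through it. So a nonempty face can be
    replaced by the set of facets that contain it: these sets form a simplicial
    complex with one maximal simplex, of size [d], for each vertex, and covering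
    means adding or removing one facet. The empty face is covered by all the
    vertices. Hence it suffices to find a Hamilton path of the complex between
    two maximal simplices; the empty face closes it to a cycle.

    Sweep the vertices in a suitable order. Each vertex [v] with set of facets
    [F] adds the sets between [R] and [F], where [R] consists of the facets [r]
    such that the edge [F :\ r] descends from [v]; every face whose lowest vertex
    is [v] appears here. A reflected Gray code lists this Boolean interval and
    is spliced into the path of the earlier sets ([rooted_path_step]). For this,
    two consecutive sets [F :\ r] and [F :\ r :\ x] with [r] in [R] and [x] not in
    [R] must be found, that is, an edge that descends from [v] next to a
    2-face that contains it and an ascending edge. They are provided by an
    invariant on the edges cut by the current level: one of them, the root,
    is the end of the path, and from every cut edge one reaches the root by
    moving across 2-faces that are next to the current edge in the path. The
    last edge below [v] on such a route is the place for the new code, and the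
    order of the code restores the invariant ([shelling_path]).

    The root has to be cut by every level, so it must join the first and the
    last vertex. No linear functional need allow this, but a ratio of affine
    functions whose denominator almost vanishes on an edge does
    ([extremal_edge]), and a generic numerator separates the vertices
    ([vertex_order]). At each vertex such a ratio compares like a linear
    functional, so that the local coordinates at a simple vertex show that the
    order is a shelling and its reverse is one too ([shell_dir]).

    These coordinates are the slacks of the [d] facets at [v] ([vertex_coord]).
    They exist because the cone of directions at [v] is pointed and is cut out
    by its facets ([cone_facet], which rests on [farkas]): [d] facet
    inequalities with no common zero are a basis of the dual space. *)

Set Implicit Arguments.
Unset Strict Implicit.
Unset Printing Implicit Defensive.

(** * Neighbours in a path *)

Section NextTo.
Variable V : eqType.
Implicit Types (q g : seq V) (x y u v : V).

(** Symmetric consecutiveness: paths are spliced from either end, so only the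
    unordered pair of neighbours matters. *)
Fixpoint next_to q u v : bool :=
  if q is x :: q' then
    (if q' is y :: _ then (x == u) && (y == v) || (x == v) && (y == u)
     else false) || next_to q' u v
  else false.

Lemma next_to_cat q1 q2 x u v :
  next_to (q1 ++ x :: q2) u v = next_to (rcons q1 x) u v || next_to (x :: q2) u v.
Proof.
elim: q1 => [|a q1 IH] //.
rewrite cat_cons rcons_cons [LHS]/= IH [next_to (a :: _) u v]/=.
by rewrite -orbA; case: q1 {IH}.
Qed.

Lemma next_to_rcons q x y u v :
  next_to (rcons (rcons q x) y) u v =
  next_to (rcons q x) u v || (x == u) && (y == v) || (x == v) && (y == u).
Proof. by rewrite -cats1 cat_rcons next_to_cat /= !orbF orbA. Qed.

Lemma next_to_rev q u v : next_to (rev q) u v = next_to q u v.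
Proof.
elim: q => // x [|y q] IH //.
rewrite rev_cons [in LHS]rev_cons next_to_rcons -rev_cons IH /=.
rewrite -[LHS]orbA [RHS]orbC; congr (_ || _).
by rewrite orbC ![(x == _) && _]andbC.
Qed.

Lemma next_toP q u v : next_to q u v ->
  exists q1 q2, q = q1 ++ u :: v :: q2 \/ q = q1 ++ v :: u :: q2.
Proof.
elim: q => // x [|y q] // IH /= /orP[/orP[]/andP[/eqP-> /eqP->]|/IH].
- by exists [::], q; left.
- by exists [::], q; right.
- by case=> q1 [q2 E]; exists (x :: q1), q2; case: E => ->; [left|right].
Qed.

Lemma next_to_catl q1 q2 u v : next_to q1 u v -> next_to (q1 ++ q2) u v.
Proof.
case/next_toP=> r1 [r2 [->|->]]; rewrite -catA next_to_cat /= !eqxx ?orbT //.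
Qed.

Lemma next_to_catr q1 q2 u v : next_to q2 u v -> next_to (q1 ++ q2) u v.
Proof.
case/next_toP=> r1 [r2 [->|->]]; rewrite catA next_to_cat /= !eqxx ?orbT //.
Qed.

(** Splicing between [x] and [y] separates that pair only. *)
Lemma next_to_insert q1 g q2 x y u v : next_to (q1 ++ x :: y :: q2) u v ->
  [\/ u = x /\ v = y, u = y /\ v = x | next_to (q1 ++ x :: g ++ y :: q2) u v].
Proof.
rewrite next_to_cat => /orP[H|].
  by constructor 3; rewrite next_to_cat H.
rewrite -[X in is_true X]/(_ || next_to (y :: q2) u v).
case/orP=> [/orP[]/andP[/eqP-> /eqP->]|H]; first by constructor 1.
  by constructor 2.
by constructor 3; rewrite next_to_cat -cat_cons next_to_cat H !orbT.
Qed.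

Lemma head_rev z q : head z (rev q) = last z q.
Proof. by elim/last_ind: q => // q x _; rewrite rev_rcons last_rcons. Qed.

Lemma last_rev z q : last z (rev q) = head z q.
Proof. by rewrite -head_rev revK. Qed.

(** A detour [a :: g], whose ends are adjacent to two neighbours [x] and [y] of
    [q], is inserted between them, reversed if [y] precedes [x] in [q]. *)
Lemma insert_path (e : rel V) q g x y a b : symmetric e ->
    next_to q x y -> sorted e q -> sorted e (a :: g) -> last a g = b ->
    e x a -> e b y ->
  exists q', [/\ perm_eq q' (q ++ a :: g), sorted e q',
    forall z, head z q' = head z q /\ last z q' = last z q,
    next_to q' b y &
    (forall u v, next_to (a :: g) u v -> next_to q' u v) /\
    forall u v, next_to q u v ->
      [\/ u = x /\ v = y, u = y /\ v = x | next_to q' u v]].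
Proof.
move=> e_sym; wlog: q g x y a b / exists q1 q2, q = q1 ++ x :: y :: q2.
  move=> W /next_toP [q1 [q2 E]] sq sg lb ex ey.
  case: E sq => -> sq.
    by apply: W; rewrite ?next_to_cat /= ?eqxx ?orbT //; exists q1, q2.
  pose p := rev (q1 ++ y :: x :: q2).
  have [|||q' [pq' sq' hl n1 [n2 n3]]]
    := W p g x y a b _ _ _ sg lb ex ey.
  - by exists (rev q2), (rev q1); rewrite /p rev_cat !rev_cons -!cats1 -!catA.
  - by rewrite next_to_rev next_to_cat /= !eqxx !orbT.
  - by rewrite rev_sorted (eq_sorted (e' := e)) // => u v; rewrite e_sym.
  exists (rev q'); split.
  - by rewrite perm_rev (perm_trans pq') // perm_cat2r perm_rev.
  - by rewrite rev_sorted (eq_sorted (e' := e)) // => u v; rewrite e_sym.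
  - by move=> z; rewrite head_rev last_rev; case: (hl z) => -> ->; rewrite head_rev last_rev.
  - by rewrite next_to_rev.
  - by split=> u v; [move/n2|rewrite -next_to_rev => /n3]; rewrite next_to_rev.
case=> q1 [q2 ->] _ sq sg lb ex ey.
exists (q1 ++ x :: (a :: g) ++ y :: q2); split.
- by rewrite -catA perm_cat2l [in X in perm_eq _ X]cat_cons perm_cons perm_catC.
- move: sq sg; rewrite !sorted_cat_cons /= cat_path /= lb ex ey.
  by move=> /and3P[-> _ ->] ->.
- by move=> z; rewrite !last_cat /= last_cat /=; case: (q1).
- have -> : q1 ++ x :: (a :: g) ++ y :: q2 = (q1 ++ x :: belast a g) ++ b :: y :: q2.
    by rewrite -lb -catA -(cat_rcons (last a g)) rcons_cons -lastI.
  by rewrite next_to_cat /= !eqxx !orbT.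
- split=> u v; last exact: next_to_insert.
  by move=> /(next_to_catl (y :: q2)) /(next_to_catr (rcons q1 x)); rewrite cat_rcons.
Qed.
End NextTo.

Lemma next_to_map (V W : eqType) (f : V -> W) q u v :
  next_to q u v -> next_to (map f q) (f u) (f v).
Proof.
case/next_toP=> q1 [q2 [->|->]]; rewrite map_cat /= next_to_cat /= !eqxx /= ?orbT //.
Qed.

(** Reflexive-transitive reachability of a fixed target [e], oriented so that
    induction peels steps off at the start. *)
Inductive reach (X : Type) (stp : X -> X -> Prop) (e : X) : X -> Prop :=
| reach_refl : reach stp e e
| reach_step B B' : stp B B' -> reach stp e B' -> reach stp e B.

(** The last visit of a path to [D]: past it, the path runs outside [D]. *)
Lemma reach_last_exit (X : Type) (stp : X -> X -> Prop) (D : pred X) e B :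
    ~~ D e -> reach stp e B ->
  let stepD x y := [/\ ~~ D x, ~~ D y & stp x y] in
  (~~ D B /\ reach stepD e B) \/
  exists d z, [/\ D d, ~~ D z, stp d z & reach stepD e z].
Proof.
move=> De rB stepD; elim: rB => [|{}B B' sBB' _ [[DB' rB']|]]; last by right.
  by left; split=> //; apply: reach_refl.
have [DB|DB] := boolP (D B); first by right; exists B, B'.
by left; split=> //; apply: reach_step rB'.
Qed.

(** * Gray codes of Boolean intervals *)

Section Adj.
Variable T : finType.
Implicit Types (A B F : {set T}) (s : seq T).

(** For sets of facets of a simple polytope, this is the cover graph of the
    faces that they cut out. *)
Definition set_adj : rel {set T} := fun A B =>
  [exists x, (x \notin A) && (B == x |: A) || (x \notin B) && (A == x |: B)].

Lemma set_adj_sym : symmetric set_adj.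
Proof. by move=> A B; apply: eq_existsb => x; rewrite orbC. Qed.

Lemma set_adjD1 A x : x \in A -> set_adj A (A :\ x).
Proof.
by move=> xA; apply/existsP; exists x; rewrite setD11 setD1K // eqxx orbT.
Qed.

Lemma set_adj_sub A B : set_adj B A -> A \subset B -> exists2 x, x \in B & A = B :\ x.
Proof.
case/existsP=> x /orP[]/andP[xB /eqP E] sAB.
  by move: xB; rewrite (subsetP sAB) // E setU11.
by exists x; rewrite E ?setU11 // setU1K.
Qed.

Lemma set_adjDr F A B : A \subset F -> B \subset F -> set_adj A B -> set_adj (F :\: A) (F :\: B).
Proof.
have adjD z (S : {set T}) : z \notin S -> z \in F -> set_adj (F :\: S) (F :\: (z |: S)).
  move=> zS zF; rewrite setUC -setDDl; apply: set_adjD1.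
  by rewrite inE zS.
move=> sA sB /existsP[z /orP[]/andP[zS /eqP E]].
  by rewrite E; apply: adjD => //; apply: (subsetP sB); rewrite E setU11.
by rewrite set_adj_sym E; apply: adjD => //; apply: (subsetP sA); rewrite E setU11.
Qed.

(** The reflected Gray code. It starts at the empty set and ends at the
    singleton of the head of the list. *)
Fixpoint gray s : seq {set T} :=
  if s is x :: s' then gray s' ++ map (setU [set x]) (rev (gray s'))
  else [:: set0].

Lemma mem_gray s A : (A \in gray s) = (A \subset s).
Proof.
elim: s A => [|x s IH] A /=.
  rewrite inE -subset0; apply/eq_subset_r => z; by rewrite inE.
rewrite mem_cat IH; apply/idP/idP.
  case/orP=> [sA|/mapP[B]].
    by apply: subset_trans sA _; apply/subsetP=> z zs; rewrite inE zs orbT.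
  rewrite mem_rev IH => /subsetP sB ->.
  by apply/subsetP=> z; rewrite !inE => /orP[->|/sB ->] //; rewrite orbT.
move=> /subsetP sA.
have [xA|xA] := boolP (x \in A); last first.
  apply/orP; left; apply/subsetP=> z zA; move: (sA z zA).
  by rewrite inE => /orP[/eqP E|//]; rewrite -E zA in xA.
apply/orP; right; apply/mapP; exists (A :\ x); last by rewrite setD1K.
rewrite mem_rev IH; apply/subsetP=> z; rewrite !inE => /andP[zx zA].
by move: (sA z zA); rewrite inE (negPf zx).
Qed.

Lemma set0_gray s : set0 \in gray s.
Proof. by rewrite mem_gray; apply/subsetP=> z; rewrite inE. Qed.

Lemma head_gray z s : head z (gray s) = set0.
Proof. by elim: s => //= x s; case: (gray s) (set0_gray s). Qed.

Lemma last_gray z x s : last z (gray (x :: s)) = [set x].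
Proof.
rewrite /= map_rev last_cat last_rev.
have := set0_gray s.
by case: (gray s) (head_gray z s) => [|A r /= ->] //; rewrite setU0.
Qed.

Lemma gray_uniq s : uniq s -> uniq (gray s).
Proof.
elim: s => //= x s IH /andP[xs /IH us].
rewrite cat_uniq us map_inj_in_uniq ?rev_uniq ?us ?andbT.
  apply/hasPn=> _ /mapP[B _ ->]; rewrite mem_gray.
  by apply: contra xs => /subsetP; apply; rewrite setU11.
have nx A : A \in rev (gray s) -> x \notin A.
  by rewrite mem_rev mem_gray => /subsetP sA; apply: contra xs => /sA.
by move=> A B /nx xA /nx xB E; rewrite -(setU1K xA) E setU1K.
Qed.

Lemma gray_sorted s : uniq s -> sorted set_adj (gray s).
Proof.
elim: s => //= x s IH /andP[xs us].
have adjU A B : x \notin A -> x \notin B -> set_adj A B -> set_adj (x |: A) (x |: B).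
  move=> xA xB /existsP[y H]; apply/existsP; exists y; case/orP: H => /andP[yA /eqP E].
  - apply/orP; left; move: xB; rewrite E !inE negb_or => /andP[xy _].
    by rewrite [y == x]eq_sym (negPf xy) yA setUCA eqxx.
  - apply/orP; right; move: xA; rewrite E !inE negb_or => /andP[xy _].
    by rewrite [y == x]eq_sym (negPf xy) yA setUCA eqxx.
have sR : sorted set_adj (map (setU [set x]) (rev (gray s))).
  apply: (@homo_sorted_in _ _ [pred A : {set T} | x \notin A] (setU [set x]) set_adj set_adj).
  - by move=> A B xA xB; apply: adjU.
  - apply/allP=> A; rewrite mem_rev mem_gray inE => /subsetP sA.
    by apply: contra xs => /sA.
  - by rewrite rev_sorted (eq_sorted (e' := set_adj)) ?IH // => A B; rewrite set_adj_sym.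
have := set0_gray s.
move: sR (IH us); case E: (gray s) => [|A r] // sR sr _.
have xL : x \notin last A r.
  have : last A r \in gray s by rewrite E mem_last.
  by rewrite mem_gray => /subsetP sA; apply: contra xs => /sA.
rewrite /= cat_path; apply/andP; split=> //.
move: sR; rewrite lastI rev_rcons /= => ->; rewrite andbT.
by rewrite set_adj_sym -{2}(setU1K xL) set_adjD1 ?setU11.
Qed.

(** In the Gray code of [y :: s2] the last set is the singleton of [y]; the
    reflection that adds [x] starts from there. *)
Lemma next_to_gray s1 x y s2 :
  next_to (gray (s1 ++ x :: y :: s2)) [set y] [set x; y].
Proof.
elim: s1 => [|a s1 IH]; last by rewrite /= next_to_catl.
rewrite cat0s -[gray _]/(gray (y :: s2) ++ map _ (rev (gray (y :: s2)))).
have := last_gray set0 y s2; case: (gray _) (set0_gray (y :: s2)) => // A r _ E.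
by rewrite lastI -[last A r]/(last set0 (A :: r)) E rev_rcons cat_rcons next_to_cat /= !eqxx !orbT.
Qed.

(** By the previous lemma the Gray code leads from each singleton, through a
    pair, to the singleton of the preceding element, hence finally to the
    singleton of the head. *)
Lemma gray_ind (Q : T -> Prop) x s : Q x ->
    (forall y z, y \in x :: s -> next_to (gray (x :: s)) [set z] [set y; z] ->
       Q y -> Q z) ->
  forall z, z \in x :: s -> Q z.
Proof.
move=> Qx Qs z zs; rewrite -(nth_index x zs).
move: zs; rewrite -index_mem; elim: (index _ _) => // i IH ltis.
apply: (Qs (nth x (x :: s) i)); last exact: IH (ltnW ltis).
  by rewrite mem_nth // ltnW.
rewrite -{1}[x :: s](cat_take_drop i) (drop_nth x (ltnW ltis)) (drop_nth x ltis).
exact: next_to_gray.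
Qed.

(** * Hamilton paths of shelled complexes *)

Section Shelling.
Variables (F : nat -> {set T}) (M d : nat).

(** [F i :\ r] is an edge through the vertex [i]; these predicates say on which
    side its other endpoint lies. *)
Definition earlier i r := [exists k : 'I_M, (k < i) && (F i :\ r \subset F k)].
Definition later i r := [exists k : 'I_M, (i < k) && (F i :\ r \subset F k)].

Hypothesis M_gt1 : 1 < M.
Hypothesis card_F : forall i, i < M -> #|F i| = d.
(** In the polytope: a face through the vertices [i] and [j], [j < i], contains
    an edge that descends from [i]. For the simplices [F i] this says that their
    order is a shelling; [shell_later] says so for the reversed order. *)
Hypothesis shell_earlier : forall i j A, j < i < M -> A \subset F i -> A \subset F j ->
  exists r, [/\ r \in F i, r \notin A & earlier i r].
Hypothesis shell_later : forall i j A, i < j < M -> A \subset F i -> A \subset F j ->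
  exists r, [/\ r \in F i, r \notin A & later i r].
Hypothesis earlierN : forall i r, i < M -> r \in F i -> earlier i r = ~~ later i r.
(** The first and the last vertex are joined by the edge [F 0 :\ y0], which
    therefore is cut by every intermediate level. *)
Variable y0 : T.
Hypothesis y0F : y0 \in F 0.
Hypothesis sub_last : F 0 :\ y0 \subset F M.-1.

Let e := F 0 :\ y0.

Lemma earlierP i r : i < M -> reflect (exists2 k, k < i & F i :\ r \subset F k) (earlier i r).
Proof.
move=> iM; apply: (iffP existsP) => [[k /andP[ki sk]]|[k ki sk]]; first by exists k.
by exists (Ordinal (ltn_trans ki iM)); rewrite /= ki.
Qed.

Lemma laterP i r : reflect (exists2 k, i < k < M & F i :\ r \subset F k) (later i r).
Proof.
apply: (iffP existsP) => [[k /andP[ki sk]]|[k /andP[ki kM] sk]].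
  by exists k; rewrite ?ki /=.
by exists (Ordinal kM); rewrite /= ki.
Qed.

(** The ridges on the boundary of the union of the first [t] simplices; dually,
    the edges of the polytope cut by a level between the vertices [t - 1] and
    [t]. *)
Definition boundary t B := [/\ #|B|.+1 = d, exists2 j, j < t & B \subset F j
  & exists2 k, t <= k < M & B \subset F k].

(** From the ridge [B] one moves to the ridge [B'] when a neighbour of [B] in
    the path [q] is contained in both. Such a neighbour marks a place at which
    a new simplex through [B] can be spliced in. *)
Definition ridge_step q t B B' := [/\ boundary t B, boundary t B' &
  exists A, [/\ next_to q B A, A \subset B & A \subset B']].

(** The invariant of the construction. Its last clause is what keeps splicing
    possible: whichever boundary ridges the next simplex swallows, one of them
    has a step to a ridge outside. *)
Definition rooted_path t q := [/\ uniq q /\ sorted set_adj q,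
  forall z, head z q = F 0 /\ last z q = e,
  forall A, A \in q <-> exists2 i, i < t & A \subset F i &
  forall B, boundary t B -> reach (ridge_step q t) e B].

Lemma ridgeE i r B : i < M -> #|B|.+1 = d -> B \subset F i -> r \in F i ->
  r \notin B -> B = F i :\ r.
Proof.
move=> iM cB sB rF rB; apply/eqP; rewrite eqEcard subsetD1 sB rB /=.
by rewrite -ltnS cB -(card_F iM) (cardsD1 r (F i)) rF.
Qed.

Lemma card_ridge i r : i < M -> r \in F i -> #|F i :\ r|.+1 = d.
Proof. by move=> iM rF; rewrite -(card_F iM) (cardsD1 r (F i)) rF. Qed.

(** The Gray code of complements: it lists the faces of [F i] that contain all
    elements outside [us]. *)
Definition gray_patch i us := map (fun S => F i :\: S) (gray us).

Lemma gray_patchP i x us : uniq (x :: us) -> {subset x :: us <= F i} ->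
  [/\ uniq (gray_patch i (x :: us)), sorted set_adj (gray_patch i (x :: us)),
    forall z, head z (gray_patch i (x :: us)) = F i /\ last z (gray_patch i (x :: us)) = F i :\ x &
    forall A, (A \in gray_patch i (x :: us)) = (A \subset F i) && (F i :\: A \subset x :: us)].
Proof.
move=> uus sus; set s := x :: us in uus sus *.
have sF S : S \in gray s -> S \subset F i.
  by rewrite mem_gray => /subset_trans; apply; apply/subsetP.
have DK (S : {set T}) : S \subset F i -> F i :\: (F i :\: S) = S.
  by move=> sS; rewrite setDDr setDv set0U; apply/setIidPr.
split.
- rewrite map_inj_in_uniq ?gray_uniq // => S S' /sF sS /sF sS' E.
  by rewrite -(DK _ sS) E DK.
- apply: (@homo_sorted_in _ _ [pred S : {set T} | S \subset F i] _ set_adj set_adj).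
  + by move=> S S' sS sS'; apply: set_adjDr.
  + by apply/allP=> S /sF.
  + exact: gray_sorted.
- move=> z; rewrite /gray_patch; split.
    by case: (gray s) (head_gray z s) (set0_gray s) => //= A r -> _; rewrite setD0.
  have := last_gray set0 x us; rewrite -/s; case: (gray s) (set0_gray s) => //= A r _ E.
  by rewrite last_map E.
- move=> A; apply/mapP/andP=> [[S /[dup] /sF sS + ->]|[sA sD]].
    by rewrite subsetDl DK // mem_gray.
  by exists (F i :\: A); rewrite ?mem_gray ?DK.
Qed.

Lemma next_to_gray_patch i us y z : next_to (gray us) [set z] [set y; z] ->
  next_to (gray_patch i us) (F i :\ z) (F i :\: [set y; z]).
Proof. exact: next_to_map. Qed.

(** Enumerate the first simplex by the Gray code with [y0] at the head: the
    code ends at the root [e], and each of its ridges has a step to the ridge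
    that omits the preceding element. *)
Lemma rooted_path_init : exists q, rooted_path 1 q.
Proof.
pose us := enum (F 0 :\ y0).
have M0 : 0 < M by apply: ltnW.
have mus : y0 :: us =i F 0.
  by move=> z; rewrite inE mem_enum !inE; case: eqP => // ->; rewrite y0F.
have uus : uniq (y0 :: us) by rewrite /= enum_uniq mem_enum setD11.
have [|uq sq hl mq] := @gray_patchP 0 y0 us uus; first by move=> z; rewrite mus.
exists (gray_patch 0 (y0 :: us)); split=> //.
  move=> A; rewrite mq; split=> [/andP[sA _]|[[]// _ sA]]; first by exists 0.
  by rewrite sA; apply/subsetP=> z /setDP[zF _]; rewrite mus.
have bd z : z \in F 0 -> boundary 1 (F 0 :\ z).
  move=> zF; split; [exact: card_ridge|by exists 0; rewrite ?subsetDl|].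
  have : later 0 z by apply: contraT; rewrite -earlierN // => /(earlierP _ M0)[].
  by case/laterP=> k k0 sk; exists k.
move=> B [cB [j]]; rewrite ltnS leqn0 => /eqP-> sB _.
have [r rF rB] : exists2 r, r \in F 0 & r \notin B.
  apply/subsetPn; apply: contraL isT => /subset_leq_card.
  by rewrite card_F // -cB ltnn.
rewrite (ridgeE M0 cB sB rF rB).
rewrite -mus in rF; move: r rF {rB}.
apply: gray_ind; first exact: reach_refl.
move=> y z ys nyz; rewrite mus in ys.
have [<-//|nyz'] := eqVneq y z.
have zF : z \in F 0.
  have /next_toP[q1 [q2 E]] := nyz.
  have : [set z] \in gray (y0 :: us).
    by case: E => ->; rewrite mem_cat !inE eqxx !orbT.
  by rewrite mem_gray => /subsetP/(_ z); rewrite !inE eqxx -mus inE; apply.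
apply: reach_step; split; [exact: bd|exact: bd|].
exists (F 0 :\: [set y; z]); split.
- exact: next_to_gray_patch nyz.
- by apply: setDS; rewrite sub1set !inE eqxx orbT.
- by apply: setDS; rewrite sub1set !inE eqxx.
Qed.

(** The faces of [F t] that are new form the Boolean interval between the set
    of the earlier elements and [F t]; a Gray code lists them from [F t] to
    [F t :\ x] for any later [x]. Take a path of ridges from a facet of [F t] to
    the root, and the last facet [D0 = F t :\ r] of [F t] on it. Its exit step
    uses a neighbour [A = F t :\ r :\ x] of [D0], where [x] is later, and the code
    fits between [D0] and [A]. Afterwards [F t :\ x] is next to [A] and takes
    over the exit step of [D0]; the other new ridges are led to [F t :\ x] by
    the code, and an old path that entered [F t] now enters one of its new
    ridges. *)
Lemma rooted_path_step t q : 0 < t < M.-1 -> rooted_path t q -> exists q', rooted_path t.+1 q'.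
Proof.
move=> /andP[t0 tM1] [[uq sq] hl mq rq].
have tM : t < M by rewrite (leq_trans tM1) ?leq_pred.
have M1M : M.-1 < M by rewrite prednK // ltnW.
(* Otherwise its single missing element would be both earlier and later. *)
have eF : ~~ (e \subset F t).
  apply/negP=> eF.
  have [r [rF re er]] := @shell_earlier t 0 e (introT andP (conj t0 tM)) eF (subsetDl _ _).
  have [s [sF se ls]] := @shell_later t M.-1 e (introT andP (conj tM1 M1M)) eF sub_last.
  have ce : #|e|.+1 = d by apply: card_ridge => //; apply: ltnW.
  have : s = r.
    move: (sF); rewrite -(setD1K rF) -(ridgeE tM ce eF rF re) in_setU1 (negPf se) orbF.
    by move/eqP.
  by move=> E; move: er; rewrite earlierN // -E ls.
have [r0 [r0F _ er0]] :=
  @shell_earlier t 0 set0 (introT andP (conj t0 tM)) (sub0set _) (sub0set _).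
have bd0 : boundary t (F t :\ r0).
  split; first exact: card_ridge.
    by case/(earlierP _ tM): er0 => k; exists k.
  by exists t; rewrite ?leqnn ?subsetDl.
have [[]|[D0 [z [dF zF sdz rz]]]] := reach_last_exit (D := fun B => B \subset F t) eF (rq _ bd0).
  by rewrite subsetDl.
case: sdz => [[cd [j jt dj] _] bz [A [ndA sAd sAz]]].
have later_of B k A' : t <= k < M -> B \subset F k -> ~~ (B \subset F t) ->
    A' \subset F t -> A' \subset B -> exists x, [/\ x \in F t, x \notin A' & later t x].
  move=> /andP[tk kM] sBk nB sA' sAB.
  apply: (@shell_later t k) => //; last exact: subset_trans sBk.
  by rewrite kM andbT ltn_neqAle tk andbT; apply: contraNneq nB => ->.
have [r [rF rd er]] : exists r, [/\ r \in F t, r \notin D0 & earlier t r].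
  by apply: (@shell_earlier t j); rewrite ?jt.
have dE := ridgeE tM cd dF rF rd.
have [x xd AE] : exists2 x, x \in D0 & A = D0 :\ x.
  apply: set_adj_sub sAd; move/next_toP: ndA sq => [q1 [q2 [->|->]]].
    by rewrite sorted_cat_cons /= => /and3P[].
  by rewrite sorted_cat_cons /= set_adj_sym => /and3P[].
(* The exit ridge [z] contains [A] and lies in a later simplex, so an element
   of [F t] missing from [A] is later; it is not [r], which is earlier. *)
have [xF lx] : x \in F t /\ later t x.
  case: bz => _ _ [k tk zk].
  have [x' [xF xA lx]] := later_of z k A tk zk zF (subset_trans sAd dF) sAz.
  suff -> : x = x' by [].
  move: xA; rewrite AE dE !inE xF andbT negb_and !negbK.
  case/predU1P=> [->//|/eqP E]; move: er; rewrite earlierN // -E lx //.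
pose U := [set u in F t | later t u].
pose us := enum (U :\ x).
have mus : x :: us =i U.
  move=> u; rewrite inE mem_enum inE inE.
  by case: eqP => // ->; rewrite !inE xF lx.
have uus : uniq (x :: us) by rewrite /= enum_uniq mem_enum setD11.
have susF : {subset x :: us <= F t} by move=> u; rewrite mus inE => /andP[].
have [ug sg hlg mg] := gray_patchP uus susF.
have rx : r != x by apply: contraTneq er => ->; rewrite earlierN // lx.
have Ab : set_adj (F t :\ x) A.
  have -> : A = (F t :\ x) :\ r by rewrite AE dE !setDDl setUC.
  by apply: set_adjD1; rewrite !inE rx.
have daF : set_adj D0 (F t) by rewrite set_adj_sym dE set_adjD1.
case gE : (gray_patch t (x :: us)) => [|a g].
  have := mg (F t); rewrite gE subxx setDv.
  by move/esym/subsetP; case=> u; rewrite inE.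
have [aE lE] : a = F t /\ last a g = F t :\ x.
  by have := hlg a; rewrite gE /= => -[].
rewrite gE in ug sg mg; rewrite aE in ug sg mg lE gE.
have [q' [pq' sq' hl' nb [ng nq]]] := insert_path set_adj_sym ndA sq sg lE daF Ab.
have mq' B : (B \in q') = (B \in q) || (B \in F t :: g).
  by rewrite (perm_mem pq') mem_cat.
have AF : A \subset F t := subset_trans sAd dF.
have bS B : boundary t B -> ~~ (B \subset F t) -> boundary t.+1 B.
  move=> [cB [k kt sk] [l /andP[tl lM] sub_k]] nB; split=> //.
    by exists k => //; apply: ltnW.
  exists l => //; rewrite lM andbT ltn_neqAle tl andbT.
  by apply: contraNneq nB => ->.
have bU u : u \in F t -> later t u -> boundary t.+1 (F t :\ u).
  move=> uF /laterP[k tk sk]; split; first exact: card_ridge.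
    by exists t; rewrite ?subsetDl.
  by exists k.
have nqF B C : ~~ (B \subset F t) -> next_to q B C -> next_to q' B C.
  by move=> nB /nq[[E _]|[E _]|//]; rewrite E ?dF ?AF in nB.
have rS B : reach (fun x y : {set T} =>
      [/\ ~~ (x \subset F t), ~~ (y \subset F t) & ridge_step q t x y]) e B ->
    reach (ridge_step q' t.+1) e B.
  elim=> [|{}B B' [nB nB' [bB bB' [C [nC sC sC']]]] _ rB']; first exact: reach_refl.
  apply: reach_step rB'; split; [exact: bS|exact: bS|].
  by exists C; split=> //; apply: nqF.
have rU : forall u, u \in x :: us -> reach (ridge_step q' t.+1) e (F t :\ u).
  apply: gray_ind.
    apply: reach_step (rS _ rz); split; [exact: bU|exact: bS|].
    exists A; split=> //; rewrite AE dE; apply: setSD; exact: subsetDl.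
  move=> u w us_u nuw ru.
  have wus : w \in x :: us.
    have /next_toP[q1 [q2 E]] := nuw.
    have : [set w] \in gray (x :: us).
      by case: E => ->; rewrite mem_cat !inE eqxx !orbT.
    by rewrite mem_gray => /subsetP/(_ w); apply; rewrite inE.
  move: (us_u) (wus); rewrite !mus !inE => /andP[uF lu] /andP[wF lw].
  apply: reach_step ru; split; [exact: bU|exact: bU|].
  exists (F t :\: [set u; w]); split.
  - by apply: ng; rewrite -gE; apply: next_to_gray_patch nuw.
  - by apply: setDS; rewrite sub1set !inE eqxx orbT.
  - by apply: setDS; rewrite sub1set !inE eqxx.
exists q'; split.
- split=> //; rewrite (perm_uniq pq') cat_uniq uq ug andbT andTb.
  apply/hasPn=> B; rewrite mg => /andP[sB /subsetP sD].
  apply/negP=> /mq[k kt sk].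
  have [s [sF sNB es]] := @shell_earlier t k B (introT andP (conj kt tM)) sB sk.
  have : s \in x :: us by apply: sD; rewrite inE sNB.
  by rewrite mus inE sF; rewrite earlierN // in es; rewrite (negPf es).
- by move=> w; rewrite (hl' w).1 (hl' w).2.
- move=> B; rewrite mq' mg; split.
    case/orP=> [/mq[k kt sk]|/andP[sB _]]; last by exists t.
    by exists k => //; apply: ltnW.
  case=> k; rewrite ltnS leq_eqVlt => /predU1P[->|kt] sB; last first.
    by apply/orP; left; apply/mq; exists k.
  rewrite sB /=; apply/orP.
  have [|/subsetPn[w wD wU]] := boolP (F t :\: B \subset x :: us); first by right.
  left; apply/mq; move: wU wD; rewrite mus !inE => wU /andP[wB wF].
  rewrite wF /= -earlierN // in wU; case/(earlierP _ tM): wU => k' kt sk.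
  by exists k' => //; apply: subset_trans sk; rewrite subsetD1 sB.
- have inF B : B \subset F t -> boundary t.+1 B -> reach (ridge_step q' t.+1) e B.
    move=> sB [cB _ [k tk sk]].
    have [s [sF sNB ls]] := @shell_later t k B tk sB sk.
    by rewrite (ridgeE tM cB sB sF sNB); apply: rU; rewrite mus inE sF.
  move=> B bB; have [sB|nB] := boolP (B \subset F t); first exact: inF.
  have : reach (ridge_step q t) e B.
    apply: rq; case: bB => cB [j' j't sj'] [k /andP[tk kM] sk]; split=> //.
      exists j' => //; move: j't; rewrite ltnS leq_eqVlt => /predU1P[E|//].
      by rewrite -E sj' in nB.
    by exists k; rewrite ?kM ?(ltnW tk).
  move=> rB; elim: rB nB {bB} => [|{}B B' [bB bB' [C [nC sC sC']]] _ IH] nB.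
    exact: reach_refl.
  have [sB'|nB'] := boolP (B' \subset F t); last first.
    apply: reach_step (IH nB'); split; [exact: bS|exact: bS|].
    by exists C; split=> //; apply: nqF.
  have sCF := subset_trans sC' sB'.
  have [w [wF wNC lw]] : exists w, [/\ w \in F t, w \notin C & later t w].
    by case: (bB) => _ _ [k tk sk]; apply: (later_of B k).
  apply: reach_step (rU w _); last by rewrite mus inE wF.
  split; [exact: bS|exact: bU|].
  by exists C; split; [exact: nqF| |rewrite subsetD1 sCF].
Qed.

(** When only the last simplex is missing, all its proper faces have been
    listed, so it can be appended to the root [e], which is one of its
    facets. *)
Theorem shelling_path : exists q : seq {set T}, [/\ uniq q, sorted set_adj q,
  forall z, head z q = F 0 /\ last z q = F M.-1 &
  forall A, A \in q <-> exists2 i, i < M & A \subset F i].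
Proof.
have H t : 0 < t <= M.-1 -> exists q, rooted_path t q.
  case/andP; elim: t => // t IH _ tM; case: (posnP t) => [->|t0]; first exact: rooted_path_init.
  by have [q] := IH t0 (ltnW tM); apply: rooted_path_step; rewrite t0.
have M1M : M.-1 < M by rewrite prednK // ltnW.
have M0 : 0 < M by apply: ltnW.
have M10 : 0 < M.-1 by rewrite -ltnS prednK.
have [q [[uq sq] hl mq _]] := H M.-1 (introT andP (conj M10 (leqnn _))).
exists (rcons q (F M.-1)); split.
- rewrite rcons_uniq uq andbT; apply/negP=> /mq[k kt sk].
  have [r [rF]] := @shell_earlier M.-1 k (F M.-1) (introT andP (conj kt M1M)) (subxx _) sk.
  by rewrite rF.
- have ce : #|e|.+1 = d by apply: card_ridge.
  have [r rF re] : exists2 r, r \in F M.-1 & r \notin e.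
    apply/subsetPn; apply: contraL isT => /subset_leq_card.
    by rewrite card_F // -ce ltnn.
  have eL : e = F M.-1 :\ r by apply: ridgeE ce sub_last rF re.
  have adjL : set_adj e (F M.-1) by rewrite set_adj_sym eL set_adjD1.
  have := (hl set0).2; case: q uq sq hl mq => [|B q] uq sq hl mq.
    by have : F 0 \in [::] by apply/mq; exists 0.
  by rewrite /= rcons_path => ->; rewrite adjL andbT.
- move=> z; rewrite last_rcons; split=> //.
  have := (hl z).1; case: q {uq sq hl} mq => [|B q] mq //.
  by have : F 0 \in [::] by apply/mq; exists 0.
- move=> A; rewrite mem_rcons inE; split.
    case/predU1P=> [->|/mq[k kt sk]]; first by exists M.-1.
    by exists k => //; apply: leq_trans kt _; apply: leq_pred.
  case=> k kM sA; have [->|AL] := eqVneq A (F M.-1); first by rewrite ?eqxx.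
  apply/mq; have [kM1|] := ltnP k M.-1; first by exists k.
  move=> Mk; have kE : k = M.-1 by apply/eqP; rewrite eqn_leq Mk andbT -ltnS prednK.
  have [r rF rA] : exists2 r, r \in F k & r \notin A.
    by apply/subsetPn; apply: contraNN AL => sFA; rewrite -kE eqEsubset sA.
  have : earlier k r.
    rewrite earlierN //; apply/laterP=> -[l]; rewrite kE; case/andP=> lt1.
    by rewrite ltnNge -[M]prednK // lt1.
  case/(earlierP _ kM)=> l lk sub_k; exists l; first by rewrite -kE.
  by apply: subset_trans sub_k; rewrite subsetD1 sA.
Qed.
End Shelling.
End Adj.

From mathcomp Require Import boolp classical_sets functions cardinality reals.
From mathcomp Require Import lra ring.

Import Order.TTheory GRing.Theory Num.Theory.
Local Open Scope ring_scope.

(** * Linear functionals *)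

Section Dot.
Variables (R : realFieldType) (n : nat).
Implicit Types (x y : 'rV[R]_n) (c : 'cV[R]_n) (k : R).

Definition dot x c : R := (x *m c) 0 0.

Lemma dotDl x y c : dot (x + y) c = dot x c + dot y c.
Proof. by rewrite /dot mulmxDl mxE. Qed.
Lemma dotNl x c : dot (- x) c = - dot x c.
Proof. by rewrite /dot mulNmx mxE. Qed.
Lemma dotBl x y c : dot (x - y) c = dot x c - dot y c.
Proof. by rewrite dotDl dotNl. Qed.
Lemma dotZl k x c : dot (k *: x) c = k * dot x c.
Proof. by rewrite /dot -scalemxAl mxE. Qed.
Lemma dot0l c : dot 0 c = 0.
Proof. by rewrite /dot mul0mx mxE. Qed.
Lemma dot_suml (I : Type) (r : seq I) (P : pred I) (f : I -> 'rV[R]_n) c :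
  dot (\sum_(i <- r | P i) f i) c = \sum_(i <- r | P i) dot (f i) c.
Proof. by rewrite /dot mulmx_suml summxE. Qed.
Lemma dotDr x c c' : dot x (c + c') = dot x c + dot x c'.
Proof. by rewrite /dot mulmxDr mxE. Qed.
Lemma dotNr x c : dot x (- c) = - dot x c.
Proof. by rewrite /dot mulmxN mxE. Qed.
Lemma dotBr x c c' : dot x (c - c') = dot x c - dot x c'.
Proof. by rewrite dotDr dotNr. Qed.
Lemma dotZr k x c : dot x (k *: c) = k * dot x c.
Proof. by rewrite /dot -scalemxAr mxE. Qed.
Lemma dot_sumr (I : Type) (r : seq I) (P : pred I) x (f : I -> 'cV[R]_n) :
  dot x (\sum_(i <- r | P i) f i) = \sum_(i <- r | P i) dot x (f i).
Proof. by rewrite /dot mulmx_sumr summxE. Qed.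

Lemma dot_col m x (A : 'M[R]_(n, m)) j : dot x (col j A) = (x *m A) 0 j.
Proof. by rewrite /dot !mxE; apply: eq_bigr => k _; rewrite mxE. Qed.

Lemma dot_tr x : x != 0 -> dot x x^T != 0.
Proof.
apply: contraNneq => /eqP; rewrite /dot mxE.
under eq_bigr do rewrite mxE -expr2.
rewrite psumr_eq0 => [/allP H|i _]; last exact: sqr_ge0.
apply/eqP/rowP=> i; rewrite mxE; apply/eqP.
by have := H i (mem_index_enum _); rewrite sqrf_eq0.
Qed.

(** By induction on the number of generators. If the inequalities of the
    generators other than [q ord0] do not suffice, some [c0] satisfies them and
    is negative at [x], hence also at [q ord0]; projecting along [q ord0] onto
    the kernel of [c0] eliminates [q ord0]. *)
Lemma farkas m (q : 'I_m -> 'rV[R]_n) x :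
    (forall c, (forall i, 0 <= dot (q i) c) -> 0 <= dot x c) ->
  exists2 l : 'I_m -> R, (forall i, 0 <= l i) & x = \sum_i l i *: q i.
Proof.
elim: m q x => [|m IH] q x xq.
  exists (fun=> 0) => //; rewrite big_ord0; apply/eqP; apply: contraT => /dot_tr.
  have x0 c : dot x c = 0.
    have H c' : 0 <= dot x c' by apply: xq => -[].
    by apply/le_anti; rewrite H andbT -oppr_ge0 -dotNr.
  by rewrite x0 eqxx.
pose q1 i := q (lift ord0 i).
have [/IH[l l0 ->]|/existsNP[c0 /not_implyP[c0q /negP]]] :=
    pselect (forall c, (forall i, 0 <= dot (q1 i) c) -> 0 <= dot x c).
  exists (fun i => oapp l 0 (unlift ord0 i)) => [i|].
    by case: unlift => /=.
  rewrite big_ord_recl unlift_none scale0r add0r.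
  by apply: eq_bigr => i _; rewrite liftK.
rewrite -ltNge => xc0.
have q0c0 : dot (q ord0) c0 < 0.
  rewrite ltNge; apply: contraTN xc0 => q0; rewrite -leNgt; apply: xq => i.
  by case: (unliftP ord0 i) => [j ->|-> //]; apply: c0q.
pose k i := dot (q1 i) c0 / - dot (q ord0) c0.
pose kx := dot x c0 / - dot (q ord0) c0.
have [c cq|l l0] := IH (fun i => q1 i + k i *: q ord0) (x + kx *: q ord0).
  have := xq (c - (dot (q ord0) c / dot (q ord0) c0) *: c0).
  have E y : dot y (c - (dot (q ord0) c / dot (q ord0) c0) *: c0) =
      dot (y + (dot y c0 / - dot (q ord0) c0) *: q ord0) c.
    rewrite dotBr dotZr dotDl dotZl; field; exact: ltr0_neq0.
  rewrite E; apply=> i; rewrite E; case: (unliftP ord0 i) => [j ->|->]; first exact: cq.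
  rewrite dotDl dotZl invrN mulrN mulfV ?ltr0_neq0 // mulN1r subrr //.
move=> E; pose l' := oapp l (\sum_i l i * k i - kx).
exists (fun i => l' (unlift ord0 i)) => [j|].
  case: (unlift ord0 j) => [i|] /=; first exact: l0.
  rewrite subr_ge0; apply: (@le_trans _ _ 0).
    by rewrite /kx ltW // pmulr_llt0 // invr_gt0 oppr_gt0.
  apply: sumr_ge0 => i _; rewrite mulr_ge0 // /k mulr_ge0 // invr_ge0 oppr_ge0 ltW //.
rewrite big_ord_recl unlift_none /=.
rewrite (eq_bigr (fun i => l i *: q1 i)) => [|i _]; last by rewrite liftK.
have -> : x = \sum_i l i *: (q1 i + k i *: q ord0) - kx *: q ord0.
  by rewrite -E addrK.
rewrite (eq_bigr (fun i => l i *: q1 i + (l i * k i) *: q ord0)) => [|i _]; last first.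
  by rewrite scalerDr scalerA.
by rewrite big_split /= -scaler_suml scalerBl -addrA addrC.
Qed.

Lemma small_pos (I : eqType) (s : seq I) (a b : I -> R) :
    (forall i, i \in s -> 0 < a i) ->
  exists2 t, 0 < t & forall i, i \in s -> t * `|b i| < a i.
Proof.
elim: s => [|i s IH] as0; first by exists 1.
have [j js|t t0 ts] := IH; first by apply: as0; rewrite inE js orbT.
have ai : 0 < a i by apply: as0; rewrite inE eqxx.
have b1 : 0 < 1 + `|b i| by rewrite ltr_pwDl.
exists (Num.min t (a i / (1 + `|b i|))).
  by rewrite lt_min t0 divr_gt0.
move=> j; rewrite inE => /predU1P[->|js].
  apply: le_lt_trans (_ : a i / (1 + `|b i|) * `|b i| < _).
    by rewrite ler_wpM2r // ge_min lexx orbT.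
  by rewrite -mulrA gtr_pMr // mulrC ltr_pdivrMr // mul1r ltrDr.
apply: le_lt_trans (ts j js).
by rewrite ler_wpM2r // ge_min lexx.
Qed.

(** A functional in the open cone cut out by [L] can be moved off finitely many
    hyperplanes without leaving the cone. *)
Lemma generic_functional (L psi : seq 'rV[R]_n) c :
    (forall x, x \in L -> 0 < dot x c) -> (forall x, x \in psi -> x != 0) ->
  exists c', (forall x, x \in L -> 0 < dot x c') /\
             (forall x, x \in psi -> dot x c' != 0).
Proof.
move=> Lc; elim: psi => [|y psi IH] psi0; first by exists c.
have [x xs|c1 [Lc1 pc1]] := IH; first by apply: psi0; rewrite inE xs orbT.
have [yc|yc] := eqVneq (dot y c1) 0; last first.
  by exists c1; split=> // x; rewrite inE => /predU1P[->|/pc1].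
have y0 : dot y y^T != 0 by apply/dot_tr/psi0; rewrite inE eqxx.
have [x|t t0 ts] := @small_pos _ (L ++ psi) (fun x => `|dot x c1|) (fun x => dot x y^T).
  by rewrite mem_cat normr_gt0 => /orP[/Lc1/lt0r_neq0|/pc1].
have tlt x : x \in L ++ psi -> `|t * dot x y^T| < `|dot x c1|.
  by move/ts; rewrite normrM (gtr0_norm t0).
exists (c1 + t *: y^T); split=> x.
  move=> xL; have := tlt x; rewrite mem_cat xL => /(_ isT).
  rewrite (gtr0_norm (Lc1 x xL)) dotDr dotZr ltr_norml => /andP[h _].
  by rewrite addrC -ltrBlDr sub0r.
rewrite inE dotDr dotZr => /predU1P[->|xp]; first by rewrite yc add0r mulf_neq0 // lt0r_neq0.
have := tlt x; rewrite mem_cat xp orbT => /(_ isT).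
by apply: contraTneq => /eqP; rewrite addr_eq0 => /eqP->; rewrite normrN ltxx.
Qed.

Lemma separate (W : {vspace 'rV[R]_n}) u : u \notin W ->
  exists2 c, (forall w, w \in W -> dot w c = 0) & dot u c != 0.
Proof.
move=> uW; pose N := \matrix_(i < \dim W) (vbasis W)`_i.
have inN w : w \in W -> (w <= N)%MS.
  move/coord_vbasis=> ->; apply: summx_sub => i _; apply: scalemx_sub.
  by rewrite (_ : _`_i = row i N) ?row_sub // rowK.
have : ~~ (u <= N)%MS.
  apply: contra uW => /submxP[D ->]; rewrite mulmx_sum_row.
  apply: memv_suml => i _; rewrite rowK memvZ // vbasis_mem // mem_nth // size_tuple //.
rewrite submxE => /eqP/rowP => H.
have [j] : exists j, (u *m cokermx N) 0 j != 0.
  apply: contra_notP H => /forallNP H j; rewrite [RHS]mxE.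
  by apply/eqP; apply: contra_notT (H j).
move=> uj; exists (col j (cokermx N)) => [w /inN|].
  by rewrite submxE dot_col => /eqP ->; rewrite mxE.
by rewrite dot_col.
Qed.
End Dot.

(** * Ratios of affine functions *)

Section Slack.
Variables (R : realFieldType) (n : nat).
Implicit Types (x v w : 'rV[R]_n).

(** A pair [(c, b)] stands for the inequality [dot x c <= b]. *)
Definition slack (h : 'cV[R]_n * R) x : R := h.2 - dot x h.1.

Lemma slackB h x v : slack h x - slack h v = - dot (x - v) h.1.
Proof. by rewrite /slack dotBl; ring. Qed.

(** Ratios of affine functions will order the vertices. After cross
    multiplication by the positive values of [b], all conditions are linear in
    the numerator, so a perturbation makes the ratio injective while it keeps
    its strict minimum [p0] and strict maximum [q0]. Affine functions become
    linear after appending a coordinate 1. *)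
Lemma generic_ratio (V : seq 'rV[R]_n) (a0 b : 'cV[R]_n * R) p0 q0 :
    (forall w, w \in V -> 0 < slack b w) ->
    (forall w, w \in V -> w != p0 -> slack a0 p0 * slack b w < slack a0 w * slack b p0) ->
    (forall w, w \in V -> w != q0 -> slack a0 w * slack b q0 < slack a0 q0 * slack b w) ->
  exists a, [/\
    forall w, w \in V -> w != p0 -> slack a p0 * slack b w < slack a w * slack b p0,
    forall w, w \in V -> w != q0 -> slack a w * slack b q0 < slack a q0 * slack b w &
    forall w w', w \in V -> w' \in V -> w != w' -> slack a w * slack b w' != slack a w' * slack b w].
Proof.
move=> b0 Hp Hq; pose hom x : 'rV[R]_(n + 1) := row_mx x (const_mx 1).
have homE x (e : 'cV[R]_(n + 1)) : dot (hom x) e = slack (- usubmx e, dsubmx e 0 0) x.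
  rewrite /slack dotNr opprK -{1}[e]vsubmxK /dot mul_row_col [LHS]mxE addrC /=.
  by congr (_ + _); rewrite mxE big_ord1 !mxE mul1r.
pose L w w' := slack b w' *: hom w - slack b w *: hom w'.
have LE w w' e : dot (L w w') e = slack (- usubmx e, dsubmx e 0 0) w * slack b w' -
    slack (- usubmx e, dsubmx e 0 0) w' * slack b w.
  by rewrite dotBl !dotZl !homE ![slack b _ * _]mulrC.
pose e0 : 'cV[R]_(n + 1) := col_mx (- a0.1) (const_mx a0.2).
have e0E x : slack (- usubmx e0, dsubmx e0 0 0) x = slack a0 x.
  by rewrite col_mxKu col_mxKd mxE opprK.
have [x|x|e [eL eN]] := @generic_functional R (n + 1)
    ([seq L w p0 | w <- V & w != p0] ++ [seq L q0 w | w <- V & w != q0])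
    [seq L u.1 u.2 | u <- [seq (w, w') | w <- V, w' <- V] & u.1 != u.2] e0.
- rewrite mem_cat => /orP[]/mapP[w]; rewrite mem_filter => /andP[ne wV] ->.
    by rewrite LE !e0E subr_gt0 Hp.
  by rewrite LE !e0E subr_gt0 Hq.
- case/mapP=> -[w w']; rewrite mem_filter => /andP[ne /allpairsP[[w1 w2] /= [wV wV']]].
  case=> E1 E2; move: ne wV wV'; rewrite -E1 -E2 => /= ne wV wV' ->.
  apply: contraNneq ne => LE0.
  have := congr1 rsubmx LE0; rewrite /L !linearB !linearZ /= !row_mxKr linear0.
  move/rowP/(_ 0); rewrite !mxE ?mulrN !mulr1 => /subr0_eq bE.
  have := congr1 lsubmx LE0; rewrite /L !linearB !linearZ /= !row_mxKl linear0 bE.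
  rewrite -scalerDr => /eqP; rewrite scaler_eq0 (gt_eqF (b0 _ wV)) subr_eq0.
  by [].
exists (- usubmx e, dsubmx e 0 0); split=> [w wV ne|w wV ne|w w' wV wV' ne].
- rewrite -subr_gt0 -LE; apply: eL; rewrite mem_cat; apply/orP; left.
  by apply/mapP; exists w; rewrite // mem_filter ne.
- rewrite -subr_gt0 -LE; apply: eL; rewrite mem_cat; apply/orP; right.
  by apply/mapP; exists w; rewrite // mem_filter ne.
- rewrite -subr_eq0 -LE; apply: eN; apply/mapP; exists (w, w') => //.
  by rewrite mem_filter ne; apply/allpairsP; exists (w, w').
Qed.

End Slack.

(** * Faces of a convex hull *)

Section Faces.
Variables (R : realType) (n m : nat) (p : 'I_m -> 'rV[R]_n).
Notation P := (conv_hull p).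
Implicit Types (F G : set 'rV[R]_n) (x v : 'rV[R]_n) (c g : 'cV[R]_n) (b : R).

(** A face is the convex hull of the generators in it, so this finite set
    encodes it. *)
Definition points_in F : {set 'I_m} := [set i | `[< F (p i) >]]%SET.

Lemma mem_points_in F i : (i \in points_in F) = `[< F (p i) >].
Proof. by rewrite inE. Qed.

Lemma conv_pt i : P (p i).
Proof.
exists (fun j => (j == i)%:R); split=> [j||].
- by rewrite ler0n.
- by rewrite (bigD1 i) //= eqxx big1 ?addr0 // => j /negPf ->.
- rewrite (bigD1 i) //= eqxx scale1r big1 ?addr0 // => j /negPf ->.
  by rewrite scale0r.
Qed.

Lemma dot_combo (a : 'I_m -> R) g b : \sum_i a i = 1 ->
  (forall i, a i != 0 -> dot (p i) g = b) -> dot (\sum_i a i *: p i) g = b.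
Proof.
move=> a1 H; rewrite dot_suml -[RHS]mul1r -a1 mulr_suml; apply: eq_bigr => i _.
by rewrite dotZl; have [->|/H->//] := eqVneq (a i) 0; rewrite !mul0r.
Qed.

Lemma conv_le c b : (forall i, dot (p i) c <= b) -> forall x, P x -> dot x c <= b.
Proof.
move=> H x [a [a0 a1 ->]]; rewrite dot_suml -[b]mul1r -a1 mulr_suml.
by apply: ler_sum => i _; rewrite dotZl ler_wpM2l.
Qed.

(** A convex combination attains a valid bound only if all points of positive
    weight do. *)
Lemma combo_tight (a : 'I_m -> R) c b : (forall i, 0 <= a i) -> \sum_i a i = 1 ->
    (forall i, dot (p i) c <= b) -> dot (\sum_i a i *: p i) c = b ->
  forall i, a i != 0 -> dot (p i) c = b.
Proof.
move=> a0 a1 H E i ai.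
have S0 : \sum_j a j * (b - dot (p j) c) = 0.
  under eq_bigr do rewrite mulrBr.
  rewrite sumrB -mulr_suml a1 mul1r -{1}E dot_suml -sumrB big1 // => j _.
  by rewrite dotZl subrr.
have nn j : true -> 0 <= a j * (b - dot (p j) c).
  by move=> _; rewrite mulr_ge0 // subr_ge0.
have /eqP := psumr_eq0P nn S0 (i := i) isT.
by rewrite mulf_eq0 (negPf ai) subr_eq0 => /eqP.
Qed.

Lemma is_faceP F : is_face P F -> exists c b,
  (forall i, dot (p i) c <= b) /\ forall x, F x <-> P x /\ dot x c = b.
Proof.
case=> c [b [H ->]]; exists c, b; split=> // i; apply: H; exact: conv_pt.
Qed.

Lemma is_face_intro F c b : (forall i, dot (p i) c <= b) ->
  (forall x, F x <-> P x /\ dot x c = b) -> is_face P F.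
Proof.
move=> H FE; exists c, b; split; first exact: conv_le.
by apply/seteqP; split=> x /FE.
Qed.

Lemma face_combo F x : is_face P F -> F x -> exists a : 'I_m -> R,
  [/\ forall i, 0 <= a i, \sum_i a i = 1, x = \sum_i a i *: p i &
      forall i, a i != 0 -> F (p i)].
Proof.
case/is_faceP=> c [b [H FE]] /FE[[a [a0 a1 xE]] xc].
exists a; split=> // i ai; apply/FE; split; first exact: conv_pt.
by apply: (combo_tight a0 a1 H) => //; rewrite -xE.
Qed.

Lemma face_combo_in F (a : 'I_m -> R) : is_face P F -> (forall i, 0 <= a i) ->
  \sum_i a i = 1 -> (forall i, a i != 0 -> F (p i)) -> F (\sum_i a i *: p i).
Proof.
case/is_faceP=> c [b [H FE]] a0 a1 aF; apply/FE; split; first by exists a.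
by apply: dot_combo => // i /aF /FE[].
Qed.

Lemma face_sub F x : is_face P F -> F x -> P x.
Proof. by case/is_faceP=> c [b [_ FE]] /FE[]. Qed.

Lemma face_subset F G : is_face P F -> is_face P G ->
  (points_in F \subset points_in G) -> (F `<=` G)%classic.
Proof.
move=> fF fG /fintype.subsetP sFG x /(face_combo fF)[a [a0 a1 -> aF]].
apply: face_combo_in => // i /aF Fi.
by apply/asboolP; rewrite -mem_points_in; apply: sFG; rewrite mem_points_in; apply/asboolP.
Qed.

Lemma points_in_inj F G : is_face P F -> is_face P G -> points_in F = points_in G -> F = G.
Proof.
by move=> fF fG E; apply/seteqP; split; apply: face_subset => //; rewrite E.
Qed.

Lemma face_ex F x : is_face P F -> F x -> exists i, F (p i).
Proof.
move=> fF /(face_combo fF)[a [_ a1 _ aF]].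
have [i ai] : exists i, a i != 0; last by exists i; apply: aF.
apply: contrapT => /forallNP H; move/eqP: a1; rewrite big1 => [|i _].
  by rewrite eq_sym oner_eq0.
by apply/eqP; apply: contra_notT (H i).
Qed.

(** The points of a face that maximize [g] form a face of the polytope: add a
    small multiple of [g] to a functional that exposes the face. *)
Lemma face_opt_face F g k : is_face P F -> F (p k) ->
    (forall i, F (p i) -> dot (p i) g <= dot (p k) g) ->
  is_face P [set x | F x /\ dot x g = dot (p k) g]%classic.
Proof.
move=> fF Fk Hk; case/is_faceP: (fF) => c [b [H FE]].
set be := dot (p k) g in Hk *.
pose s := [seq i <- enum 'I_m | dot (p i) c < b].
have [i|t t0 ts] := @small_pos _ _ s (fun i => b - dot (p i) c) (fun i => dot (p i) g - be).
  by rewrite mem_filter subr_gt0 => /andP[].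
have strict i : dot (p i) c < b -> dot (p i) (c + t *: g) < b + t * be.
  move=> ib; have : i \in s by rewrite mem_filter ib mem_enum.
  move/ts; rewrite dotDr dotZr.
  have := ler_norm (dot (p i) g - be); set y := `|_|; move=> h1 h2.
  have : t * (dot (p i) g - be) <= t * y by rewrite ler_wpM2l // ltW.
  by rewrite mulrBr; lra.
have Hv i : dot (p i) (c + t *: g) <= b + t * be.
  have := H i; rewrite le_eqVlt => /predU1P[E|/strict/ltW//].
  rewrite dotDr dotZr E lerD2l; apply: ler_wpM2l; [exact: ltW|apply: Hk].
  by apply/FE; split=> //; exact: conv_pt.
apply: (is_face_intro Hv) => x; split.
  by case=> /FE[Px xc] xg; split=> //; rewrite dotDr dotZr xc xg.
case=> -[a [a0 a1 ->]] xE.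
have tight := combo_tight a0 a1 Hv xE.
have ib i : a i != 0 -> dot (p i) c = b.
  move=> /tight E; apply/eqP; have := H i; rewrite le_eqVlt => /orP[//|/strict].
  by rewrite E ltxx.
split.
  by apply: face_combo_in => // i /ib ic; apply/FE; split=> //; exact: conv_pt.
apply: dot_combo => // i ai; have := tight i ai; rewrite dotDr dotZr ib // => /addrI.
by move/(mulfI (lt0r_neq0 t0)).
Qed.

(** Maximize [g] on the face, then a functional that separates the generators:
    what is left is a single point. *)
Lemma face_vertex F g x0 : is_face P F -> F x0 ->
  exists k, [/\ F (p k), is_vertex P (p k) & forall x, F x -> dot x g <= dot (p k) g].
Proof.
move=> fF Fx0; have [i0 Fi0] := face_ex fF Fx0.
have step G h i : is_face P G -> G (p i) -> exists2 k, G (p k) &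
    forall j, G (p j) -> dot (p j) h <= dot (p k) h.
  move=> fG Gi.
  case: (@Order.TotalTheory.arg_maxP _ _ _ i (fun i => `[<G (p i)>]) (fun i => dot (p i) h)).
    exact/asboolP.
  by move=> k /asboolP Gk Hk; exists k => // j /asboolP; apply: Hk.
have [k1 Fk1 Hk1] := step F g i0 fF Fi0.
have fF1 := face_opt_face fF Fk1 Hk1.
pose psi := [seq p u.1 - p u.2 | u <- enum [pred u : 'I_m * 'I_m | p u.1 != p u.2]].
have [|x|h [_ hinj]] := @generic_functional R n [::] psi 0; first by [].
  by case/mapP=> u; rewrite mem_enum inE => uP ->; rewrite subr_eq0.
have [k2 [Fk2 gk2] Hk2] := step _ h k1 fF1 (conj Fk1 erefl).
have fF2 := face_opt_face fF1 (conj Fk2 gk2) Hk2.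
have Hx x : F x -> dot x g <= dot (p k2) g.
  move=> /(face_combo fF)[a [a0 a1 -> aF]].
  rewrite gk2 dot_suml -[X in _ <= X]mul1r -a1 mulr_suml.
  apply: ler_sum => i _; rewrite dotZl.
  by have [->|/aF/Hk1] := eqVneq (a i) 0; rewrite ?mul0r // => ?; rewrite ler_wpM2l.
exists k2; split=> //.
rewrite /is_vertex; suff <- : [set x | (F x /\ dot x g = dot (p k1) g) /\
    dot x h = dot (p k2) h]%classic = [set p k2]%classic by [].
apply/seteqP; split=> x /=; last by move=> ->.
move=> /(face_combo fF2)[a [a0 a1 -> aF]].
rewrite -[RHS]scale1r -a1 scaler_suml; apply: eq_bigr => i _.
have [->|ai] := eqVneq (a i) 0; first by rewrite !scale0r.
congr (_ *: _); have [_ ih] := aF i ai; apply/eqP; apply: contraT => ne.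
have := hinj (p i - p k2); rewrite dotBl ih subrr eqxx => /(_ _)/negP[] //.
by apply/mapP; exists (i, k2); rewrite // mem_enum.
Qed.

Lemma vertex_pt v : is_vertex P v -> exists k, v = p k.
Proof. by move=> fv; have [k] := face_ex fv (erefl v); exists k. Qed.

Lemma affine_hull_span (A : set 'rV[R]_n) v (W : {vspace 'rV[R]_n}) (X : seq 'rV[R]_n) :
    A v -> (forall x, A x -> x - v \in W) ->
    (W <= <<[seq x - v | x <- X]>>)%VS -> (forall x, x \in X -> A x) ->
  forall x, affine_hull A x <-> x - v \in W.
Proof.
move=> Av AW sWX XA x; split.
  case=> k [q [a [Aq a1 ->]]].
  have -> : \sum_i a i *: q i - v = \sum_i a i *: (q i - v).
    rewrite [RHS](eq_bigr (fun i => a i *: q i - a i *: v)) => [|i _]; last exact: scalerBr.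
    by rewrite sumrB -scaler_suml a1 scale1r.
  by apply: memv_suml => i _; rewrite memvZ // AW.
move=> xW; have := subvP sWX _ xW; set Y := map _ X => xY.
have sY : size Y = size X by rewrite size_map.
have := @coord_span _ _ _ (in_tuple Y) (x - v) xY.
set co := (fun i : 'I_(size Y) => coord (in_tuple Y) i (x - v)).
move=> E; exists (size Y).+1.
exists (fun i => oapp (fun j : 'I_(size Y) => X`_j) v (unlift ord0 i)).
exists (fun i => oapp co (1 - \sum_j co j) (unlift ord0 i)); split.
- move=> i; case: (unlift ord0 i) => [j|] //=.
  by apply/XA/mem_nth; rewrite -sY.
- rewrite big_ord_recl unlift_none /=.
  rewrite [X in _ + X](eq_bigr co) => [|i _]; last by rewrite liftK.
  by rewrite subrK.
- rewrite big_ord_recl unlift_none /=.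
  rewrite [X in _ + X](eq_bigr (fun i => co i *: X`_i)) => [|i _]; last by rewrite liftK.
  rewrite scalerBl scale1r -[LHS](subrK v) E addrC -addrA; congr (_ + _).
  rewrite scaler_suml -sumrN -big_split; apply: eq_bigr => i _ /=.
  rewrite (nth_map 0) -?sY // -/(co i) scalerBr addrC; congr (_ + _).
Qed.

(** For a set through [v], dimension is the dimension of the span of the
    differences with [v], which finitely many points already generate. *)
Lemma has_dimE (A : set 'rV[R]_n) v (W : {vspace 'rV[R]_n}) (X : seq 'rV[R]_n) r :
    A v -> (forall x, A x -> x - v \in W) ->
    (W <= <<[seq x - v | x <- X]>>)%VS -> (forall x, x \in X -> A x) ->
  has_dim A r <-> \dim W = r.
Proof.
move=> Av AW sWX XA; have H := affine_hull_span Av AW sWX XA; split; last first.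
  move=> <-; exists v, W; split=> //; apply/seteqP; split=> x /=.
    by move/H => xW; exists (x - v) => //; rewrite addrC subrK.
  by case=> u uW <-; apply/H; rewrite addrC addKr.
case=> x0 [U [<- E]]; congr (\dim _); apply/eqP; apply/eqP/vspaceP => w.
have [u0 u0U u0E] : [set x0 + u | u in [set` U]]%classic v.
  by rewrite -E; apply/H; rewrite subrr mem0v.
apply/idP/idP => wW.
  have : affine_hull A (v + w) by apply/H; rewrite addrC addKr.
  rewrite E => -[u uU]; rewrite -u0E -addrA => /addrI uE.
  by rewrite -(addKr u0 w) -uE memvD // memvN.
have : affine_hull A (v + w).
  by rewrite E; exists (u0 + w); rewrite ?addrA ?u0E //=; apply: memvD.
by move/H; rewrite addrC addKr.
Qed.
End Faces.

(** * Facets of finitely generated cones *)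

Section Cone.
Variables (R : realFieldType) (n m : nat) (q : 'I_m -> 'rV[R]_n).
Implicit Types (u : 'rV[R]_n) (c : 'cV[R]_n).

Definition in_cone u := exists2 l : 'I_m -> R, (forall i, 0 <= l i) & u = \sum_i l i *: q i.

(** The generators on the face of the cone cut out by [c]. *)
Definition tight c : seq 'rV[R]_n := [seq q i | i <- enum 'I_m & dot (q i) c == 0].

Lemma mem_tight c i : dot (q i) c = 0 -> q i \in tight c.
Proof. by move=> E; apply: map_f; rewrite mem_filter E eqxx mem_enum. Qed.

Lemma tight_span c (W : {vspace 'rV[R]_n}) :
  (forall i, dot (q i) c = 0 -> q i \in W) -> (<<tight c>> <= W)%VS.
Proof.
move=> H; apply/span_subvP => x /mapP[i]; rewrite mem_filter => /andP[/eqP ic _] ->.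
exact: H.
Qed.

Lemma span_dot0 (X : seq 'rV[R]_n) c : (forall x, x \in X -> dot x c = 0) ->
  forall w, w \in <<X>>%VS -> dot w c = 0.
Proof.
move=> H w /(@coord_span _ _ _ (in_tuple X)) ->; rewrite dot_suml big1 // => i _.
by rewrite dotZl H ?mulr0 // mem_nth.
Qed.

Lemma tight_dot0 c w : w \in <<tight c>>%VS -> dot w c = 0.
Proof.
by apply: span_dot0 => x /mapP[i]; rewrite mem_filter => /andP[/eqP + _] ->.
Qed.

Let W0 := <<codom q>>%VS.

Lemma mem_span_gen i : q i \in W0.
Proof. by apply/memv_span/codom_f. Qed.

(** A vector outside a finitely generated cone violates the inequality of some
    facet of the cone. Farkas gives a valid functional [c] that is negative at
    [u]. While its tight generators span too little, some [g] vanishes on them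
    and at [u] but not on the whole span; moving from [c] in the direction [g]
    until a further generator becomes tight enlarges the span and does not
    change the value at [u]. *)
Lemma cone_facet u : u \in W0 -> ~ in_cone u -> exists c,
  [/\ forall i, 0 <= dot (q i) c, dot u c < 0 & (\dim <<tight c>>).+1 = \dim W0].
Proof.
move=> uW nu.
have [c [cq cu]] : exists c, (forall i, 0 <= dot (q i) c) /\ dot u c < 0.
  apply: contrapT => /forallNP H; apply: nu; apply: farkas => c cq.
  by rewrite leNgt; apply/negP => uc; apply: (H c).
have [k] := ubnP (\dim W0 - \dim <<tight c>>); elim: k c cq cu => // k IH c cq cu.
rewrite ltnS => lek.
have sZW : (<<tight c>> <= W0)%VS by apply: tight_span => i _; apply: mem_span_gen.
have uZ : u \notin <<tight c>>%VS.
  by apply/negP => /tight_dot0 uc; rewrite uc ltxx in cu.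
have u0 : u != 0 by apply: contraNneq uZ => ->; apply: mem0v.
have dZu : \dim (<<tight c>> + <[u]>) = (\dim <<tight c>>).+1.
  rewrite dimv_disjoint_sum ?dim_vline ?u0 ?addn1 //.
  apply/eqP; rewrite -subv0; apply/subvP => w; rewrite memv_cap memv0.
  case/andP=> wZ /vlineP[a wE]; apply: contraNT uZ => w0.
  have a0 : a != 0 by apply: contraNneq w0 => a0; rewrite wE a0 scale0r.
  by rewrite -(scalerK a0 u) -wE memvZ.
have sZuW : (<<tight c>> + <[u]> <= W0)%VS.
  by rewrite subv_add sZW -memvE.
have := dimvS sZuW; rewrite dZu leq_eqVlt => /predU1P[E|lt]; first by exists c.
have [i qi] : exists i, q i \notin (<<tight c>> + <[u]>)%VS.
  apply: contrapT => /forallNP H; move: lt; rewrite ltnNge -dZu dimvS //.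
  apply/span_subvP => x /codomP[i ->]; apply: contra_notT (H i) => //.
have [g gZ gi] : exists2 g,
    (forall w, w \in (<<tight c>> + <[u]>)%VS -> dot w g = 0) & dot (q i) g < 0.
  have [g gZ gi] := separate qi.
  have [gn|gp|g0] := ltgtP (dot (q i) g) 0; first by exists g.
    exists (- g) => [w /gZ|]; first by rewrite dotNr => ->; rewrite oppr0.
    by rewrite dotNr oppr_lt0.
  by rewrite g0 eqxx in gi.
have gu : dot u g = 0 by apply/gZ/(subvP (addvSr _ _))/memv_line.
have gt j : dot (q j) c = 0 -> dot (q j) g = 0.
  by move=> jc; apply/gZ/(subvP (addvSl _ _))/memv_span/mem_tight.
(* [rt j] is the time at which the generator [j] becomes tight. *)
pose rt j := dot (q j) c / - dot (q j) g.
case: (@Order.TotalTheory.arg_minP _ _ _ i (fun j => dot (q j) g < 0) rt gi) => j jg jmin.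
have t0 : 0 <= rt j by rewrite divr_ge0 // oppr_ge0 ltW.
have E w : dot w (c + rt j *: g) = dot w c + rt j * dot w g by rewrite dotDr dotZr.
apply: (IH (c + rt j *: g)).
- move=> i'; rewrite E; have [ig|ig] := ltP (dot (q i') g) 0; last first.
    by rewrite addr_ge0 // mulr_ge0.
  have := jmin i' ig; rewrite [X in _ <= X]/rt ler_pdivlMr ?oppr_gt0 //.
  by rewrite mulrN -subr_ge0 opprK.
- by rewrite E gu mulr0 addr0.
have jE : dot (q j) (c + rt j *: g) = 0.
  by rewrite E /rt invrN mulrN mulNr divfK ?ltr0_neq0 // subrr.
have lt' : (\dim <<tight c>> < \dim <<tight (c + rt j *: g)>>)%N.
  have s1 : (<<tight c>> <= <<tight (c + rt j *: g)>>)%VS.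
    by apply: tight_span => i' ic; rewrite memv_span // mem_tight // E ic gt // mulr0 addr0.
  rewrite ltn_neqAle dimvS // andbT; apply: contraTneq jg => dE.
  have /eqP eZ : (<<tight c>> == <<tight (c + rt j *: g)>>)%VS by rewrite eqEdim s1 dE leqnn.
  have : q j \in <<tight c>>%VS by rewrite eZ memv_span // mem_tight.
  by move=> /tight_dot0/gt ->; rewrite ltxx.
by apply: leq_trans lek; rewrite ltn_sub2l // -dZu; apply: leq_trans (dimvS sZuW); rewrite dZu.
Qed.
End Cone.

(** * Simple vertices *)

Section Vertex.
Variables (R : realType) (n m : nat) (p : 'I_m -> 'rV[R]_n).
Notation P := (conv_hull p).
Notation label := {set 'I_m}.
Implicit Types (F G : set 'rV[R]_n) (x v w : 'rV[R]_n) (c g : 'cV[R]_n) (b : R).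
Implicit Types (s t r : label) (A B : {set label}).

(** Labels of facets are sets of generators, so that they form a finite type.
    One inequality is chosen for each facet once and for all; it serves at
    every vertex of the facet. *)
Lemma facet_slack : exists ineq : label -> 'cV[R]_n * R, forall F, is_facet P F ->
  (forall i, 0 <= slack (ineq (points_in p F)) (p i)) /\
  (forall x, P x -> F x <-> slack (ineq (points_in p F)) x = 0).
Proof.
have /choice[ineq ineqP] : forall s, exists h : 'cV[R]_n * R,
    forall F, is_facet P F -> points_in p F = s ->
    (forall i, 0 <= slack h (p i)) /\ (forall x, P x -> F x <-> slack h x = 0).
  move=> s; have [[F [fF Fs]]|H] := pselect (exists F, is_facet P F /\ points_in p F = s).
    case: (fF) => /is_faceP[c [b [Hc FE]]] _; exists (c, b) => G fG Gs.
    have -> : G = F by apply: points_in_inj (fG.1) (fF.1) _; rewrite Fs.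
    split=> [i|x Px]; first by rewrite subr_ge0.
    by rewrite FE /slack /=; split=> [[_ ->]|/subr0_eq->]; rewrite ?subrr.
  by exists (0, 0) => F fF Fs; case: H; exists F.
by exists ineq => F fF; apply: (ineqP _ F).
Qed.

Variable ineq : label -> 'cV[R]_n * R.
Hypothesis ineqP : forall F, is_facet P F ->
  (forall i, 0 <= slack (ineq (points_in p F)) (p i)) /\
  (forall x, P x -> F x <-> slack (ineq (points_in p F)) x = 0).
Notation y := (fun s => slack (ineq s)).

Definition facets_at v : {set label} :=
  [set s | `[< exists F, [/\ is_facet P F, F v & points_in p F = s] >]]%SET.

Lemma facets_atP v s : reflect (exists F, [/\ is_facet P F, F v & points_in p F = s]) (s \in facets_at v).
Proof. by rewrite inE; apply: asboolP. Qed.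

Lemma slack_ge0 v s x : s \in facets_at v -> P x -> 0 <= y s x.
Proof.
case/facets_atP=> F [fF _ <-] Px; rewrite subr_ge0; apply: conv_le Px => i.
by rewrite -subr_ge0; apply: (ineqP fF).1.
Qed.

Lemma slack_eq0 v s w : s \in facets_at v -> P w -> (y s w = 0) <-> s \in facets_at w.
Proof.
case/facets_atP=> F [fF Fv <-] Pw; rewrite -((ineqP fF).2 w Pw); split.
  by move=> Fw; apply/facets_atP; exists F.
case/facets_atP=> G [fG Gw E].
by rewrite -(points_in_inj fG.1 fF.1 E).
Qed.

Section At.
Variable (v : 'rV[R]_n) (d : nat).
Hypothesis vP : is_vertex P v.
Hypothesis dimP : has_dim P d.
Hypothesis simple_v : (card_eq [set F | is_facet P F /\ F v] (`I_d))%classic.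

Let Pv : P v. Proof. exact: face_sub vP (erefl v). Qed.
Let q i := p i - v.
Let W0 := <<codom q>>%VS.

Lemma slack_at s : s \in facets_at v -> y s v = 0.
Proof. by move=> sv; apply/(slack_eq0 sv). Qed.

Lemma slack_dot s x : s \in facets_at v -> y s x = - dot (x - v) (ineq s).1.
Proof. by move=> sv; rewrite -slackB slack_at // subr0. Qed.

Lemma card_facets_at : #|facets_at v| = d.
Proof.
have /card_set_bijP[f [fun_f inj_f surj_f]] := simple_v.
have /choice[h hP] : forall j : 'I_d, exists F, (is_facet P F /\ F v) /\ f F = j.
  by move=> j; have [F AF fF] := surj_f j (ltn_ord j); exists F.
have hinj : injective (points_in p \o h).
  move=> i j /= E; apply: ord_inj; have [[fi _] <-] := hP i; have [[fj _] <-] := hP j.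
  by rewrite (points_in_inj fi.1 fj.1 E).
have -> : facets_at v = [set (points_in p \o h) j | j : 'I_d]%SET.
  apply/setP => s; apply/facets_atP/imsetP => [[F [fF Fv <-]]|[j _ ->]].
    have fFd : (f F < d)%N by apply: fun_f.
    exists (Ordinal fFd) => //=; have [[fh hv] hE] := hP (Ordinal fFd).
    by rewrite (inj_f (h (Ordinal fFd)) F) ?inE.
  by have [[fh hv] _] := hP j; exists (h j).
by rewrite card_imset // card_ord.
Qed.

Lemma combo_dir (a : 'I_m -> R) : \sum_i a i = 1 -> \sum_i a i *: p i - v = \sum_i a i *: q i.
Proof.
move=> a1; rewrite [RHS](eq_bigr (fun i => a i *: p i - a i *: v)) => [|i _]; last exact: scalerBr.
by rewrite sumrB -scaler_suml a1 scale1r.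
Qed.

Lemma dir_W0 x : P x -> x - v \in W0.
Proof.
move=> [a [_ a1 ->]]; rewrite combo_dir //; apply: memv_suml => i _.
by rewrite memvZ // mem_span_gen.
Qed.

Lemma dim_W0 : \dim W0 = d.
Proof.
apply: (@has_dimE R n P v W0 (codom p) d Pv dir_W0 _ _).1 => //.
  by rewrite /W0 /codom /image_mem -map_comp.
by move=> x /codomP[i ->]; apply: conv_pt.
Qed.

Lemma tight_is_facet c : (forall i, 0 <= dot (q i) c) -> (\dim <<tight q c>>).+1 = d ->
  is_facet P [set x | P x /\ dot (x - v) c = 0]%classic.
Proof.
move=> cq dc; set F := [set x | _]%classic.
have fF : is_face P F.
  apply: (@is_face_intro _ _ _ p F (- c) (dot v (- c))) => [i|x].
    by have := cq i; rewrite !dotNr dotBl; lra.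
  by rewrite /F /= !dotNr dotBl; split=> -[Px E]; split=> //; lra.
split=> //; exists (\dim <<tight q c>>); split; first by rewrite dc.
have Fv : F v by split=> //; rewrite subrr dot0l.
apply: (@has_dimE R n F v <<tight q c>>%VS [seq p i | i <- enum 'I_m & dot (q i) c == 0]
  _ Fv _ _ _).2 => //.
- move=> x /(face_combo fF)[a [_ a1 -> aF]]; rewrite combo_dir //.
  apply: memv_suml => i _; have [->|/aF[_ E]] := eqVneq (a i) 0; first by rewrite scale0r mem0v.
  by rewrite memvZ // memv_span // mem_tight.
- by rewrite -map_comp.
- move=> x /mapP[i]; rewrite mem_filter => /andP[/eqP E _] ->.
  by split=> //; apply: conv_pt.
Qed.

(** The facet inequalities at [v] describe the cone of directions at [v]. If
    [u] satisfies them but is not in the cone, [cone_facet] yields a facet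
    through [v] and a functional [c] for it that is negative at [u]; the chosen
    inequality of this facet vanishes on the same hyperplane of the span, hence
    is a multiple of [c], and by a generator off the facet the multiple is
    positive. *)
Lemma cone_slack u : u \in W0 -> (forall s, s \in facets_at v -> dot u (ineq s).1 <= 0) ->
  in_cone q u.
Proof.
move=> uW us; apply: contrapT => /(cone_facet uW)[c [cq cu]]; rewrite dim_W0 => dc.
have fF := tight_is_facet cq dc; set F := [set x | _]%classic in fF.
have Fv : F v by split=> //; rewrite subrr dot0l.
set s := points_in p F; have sv : s \in facets_at v by apply/facets_atP; exists F.
have [i qi] : exists i, dot (q i) c != 0.
  apply: contrapT => /forallNP H; move: cu; rewrite (_ : dot u c = 0) ?ltxx //.
  by apply: (span_dot0 _ uW) => x /codomP[i ->]; apply/eqP; apply: contra_notT (H i).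
have uZ : u \notin <<tight q c>>%VS.
  by apply/negP => /tight_dot0 uc; rewrite uc ltxx in cu.
have sW : (<<tight q c>> + <[u]> <= W0)%VS.
  rewrite subv_add -memvE uW andbT; apply: tight_span => j _; exact: mem_span_gen.
have /eqP WE : (<<tight q c>> + <[u]> == W0)%VS.
  rewrite eqEdim sW dim_W0 -dc ltn_neqAle dimvS ?addvSl // andbT.
  apply: contraNneq uZ => dE.
  have /eqP -> : (<<tight q c>> == <<tight q c>> + <[u]>)%VS.
    by rewrite eqEdim addvSl dE leqnn.
  by apply: (subvP (addvSr _ _)); apply: memv_line.
have : q i \in W0 by apply: mem_span_gen.
rewrite -WE => /memv_addP[z zZ [w' /vlineP[k ->] qE]].
have kE : dot (q i) c = k * dot u c by rewrite qE dotDl dotZl (tight_dot0 zZ) add0r.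
have k0 : k < 0.
  have : 0 < dot (q i) c by rewrite lt0r qi cq.
  by rewrite kE nmulr_lgt0.
have zs : dot z (ineq s).1 = 0.
  apply: (span_dot0 _ zZ) => x /mapP[j]; rewrite mem_filter => /andP[/eqP jc _] ->.
  apply/eqP; rewrite -oppr_eq0 -slack_dot //; apply/eqP/((ineqP fF).2 _ (conv_pt p j)).
  by split=> //; apply: conv_pt.
have : y s (p i) = 0.
  apply/le_anti; rewrite (slack_ge0 sv (conv_pt p i)) andbT slack_dot // -/(q i) qE.
  by rewrite dotDl zs add0r dotZl oppr_le0 nmulr_rge0 // us.
by move/((ineqP fF).2 _ (conv_pt p i)) => -[_ E]; rewrite E eqxx in qi.
Qed.

(** The functional that exposes the vertex is negative at every nonzero
    direction. *)
Lemma cone_pointed u : in_cone q u -> in_cone q (- u) -> u = 0.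
Proof.
move=> [l l0 uE] [k k0 nuE]; case/is_faceP: (vP) => c [b [cb cE]].
have vc : dot v c = b by have [_] := (cE v).1 erefl.
have qc i : q i != 0 -> dot (q i) c < 0.
  move=> qi; rewrite dotBl vc subr_lt0 lt_neqAle cb andbT; apply: contraNneq qi => E.
  by rewrite subr_eq0; apply/eqP; apply: (cE (p i)).2; split=> //; apply: conv_pt.
have S0 : \sum_i (l i + k i) * - dot (q i) c = 0.
  have -> : \sum_i (l i + k i) * - dot (q i) c = - dot (u + - u) c.
    rewrite {1}uE nuE dotDl !dot_suml -big_split -sumrN; apply: eq_bigr => i _ /=.
    by rewrite !dotZl; ring.
  by rewrite subrr dot0l oppr0.
have nn i : true -> 0 <= (l i + k i) * - dot (q i) c.
  move=> _; rewrite mulr_ge0 ?addr_ge0 // oppr_ge0.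
  by have [->|/qc/ltW//] := eqVneq (q i) 0; rewrite dot0l.
rewrite uE big1 // => i _; have [->|/qc qi] := eqVneq (q i) 0; first by rewrite scaler0.
have /eqP := psumr_eq0P nn S0 (i := i) isT.
rewrite mulf_eq0 oppr_eq0 (negPf (ltr0_neq0 qi)) orbF paddr_eq0 // => /andP[/eqP -> _].
by rewrite scale0r.
Qed.

(** The [d] slacks are linear coordinates on the [d]-dimensional span of the
    directions at [v]: a common zero [u] lies in the cone together with [- u].
    The dual basis vector [u s] has nonnegative slacks, so it is in the cone,
    and a generator that occurs in it lies on the edge on which only the
    slack of [s] varies. *)
Lemma vertex_coord : exists u : label -> 'rV[R]_n,
  (forall x, P x -> x - v = \sum_(s in facets_at v) y s x *: u s) /\
  forall s, s \in facets_at v -> exists2 i, 0 < y s (p i) &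
    forall t, t \in facets_at v -> t != s -> y t (p i) = 0.
Proof.
have inj u : u \in W0 -> (forall s, s \in facets_at v -> dot u (ineq s).1 = 0) -> u = 0.
  move=> uW us; apply: cone_pointed; apply: cone_slack.
  - by [].
  - by move=> s /us ->.
  - by rewrite memvN.
  - by move=> s /us E; rewrite dotNl E oppr0.
pose C := \matrix_(i < n, j < #|facets_at v|) - (ineq (enum_val j)).1 i 0.
have CE u j : (u *m C) 0 j = - dot u (ineq (enum_val j)).1.
  rewrite -dotNr -dot_col; congr dot; apply/matrixP => i k; rewrite !mxE ord1.
  by [].
have eqd : \dim W0 = #|facets_at v| by rewrite dim_W0 card_facets_at.
pose B := \matrix_(i < #|facets_at v|) (vbasis W0)`_i.
have BW (w : 'rV[R]_#|facets_at v|) : w *m B \in W0.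
  rewrite mulmx_sum_row; apply: memv_suml => i _; rewrite rowK memvZ // vbasis_mem //.
  by rewrite mem_nth // size_tuple eqd.
have B0 (w : 'rV[R]_#|facets_at v|) : w *m B = 0 -> w = 0.
  move=> E; apply/rowP => i; rewrite mxE.
  have := vbasisP W0; rewrite /basis_of => /andP[_ /freeP fr].
  have ei := cast_ord (esym eqd) i.
  have := fr (fun j => w 0 (cast_ord eqd j)) _ (cast_ord (esym eqd) i).
  rewrite cast_ordKV; apply; rewrite -[RHS]E mulmx_sum_row.
  rewrite (reindex (cast_ord (esym eqd))) /=; last first.
    by exists (cast_ord eqd) => j _; rewrite ?cast_ordK ?cast_ordKV.
  by apply: eq_bigr => j _; rewrite cast_ordKV rowK.
have BC : B *m C \in unitmx.
  rewrite -row_free_unit -kermx_eq0; apply/eqP/row_matrixP => i; rewrite row0.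
  have : row i (kermx (B *m C)) *m (B *m C) = 0 by rewrite -row_mul mulmx_ker row0.
  rewrite mulmxA => E; apply: B0; apply: inj (BW _) _ => s sv.
  have := congr1 (fun M : 'rV_ _ => - M 0 (enum_rank_in sv s)) E.
  by rewrite CE opprK enum_rankK_in // mxE oppr0.
(* The rows of [D] form the basis dual to the slacks, which are the columns of
   [C]; the rows of [B] are a basis of the span. *)
pose D := invmx (B *m C) *m B.
have DC : D *m C = 1%:M by rewrite -mulmxA mulVmx.
have DW j : row j D \in W0 by rewrite row_mul BW.
pose u s := \sum_(j | enum_val j == s) row j D.
have uE j : u (enum_val j) = row j D.
  by rewrite /u (big_pred1 j) // => k; rewrite (inj_eq enum_val_inj).
have uC j s : s \in facets_at v -> dot (row j D) (ineq s).1 = - (enum_val j == s)%:R.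
  move=> sv; apply/eqP; rewrite -eqr_oppLR; apply/eqP.
  rewrite -(enum_rankK_in sv sv) -CE -row_mul DC !mxE (inj_eq enum_val_inj).
  by [].
exists u; split=> [x Px|s sv].
  apply/eqP; rewrite -subr_eq0; apply/eqP; apply: inj.
    rewrite memvB ?dir_W0 //; apply: memv_suml => s _; rewrite memvZ //.
    by apply: memv_suml => j _; apply: DW.
  move=> s sv; rewrite dotBl dot_suml big_enum_val /=.
  rewrite (bigD1 (enum_rank_in sv s)) //= big1 => [|j js].
    by rewrite dotZl uE uC ?enum_rankK_in // eqxx slack_dot // mulrN mulr1 opprK addr0 subrr.
  rewrite dotZl uE uC // -{1}(enum_rankK_in sv sv) (inj_eq enum_val_inj) (negPf js).
  by rewrite oppr0 mulr0.
have [l l0 usE] : in_cone q (u s).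
  rewrite -(enum_rankK_in sv sv) uE; apply: cone_slack => // t tv.
  by rewrite uC // oppr_le0 ler0n.
have dus t : t \in facets_at v -> (s == t)%:R = \sum_i l i * y t (p i).
  move=> tv; have := uC (enum_rank_in sv s) t tv.
  rewrite -uE enum_rankK_in // usE dot_suml => /eqP; rewrite -eqr_oppLR => /eqP <-.
  by rewrite -sumrN; apply: eq_bigr => i _; rewrite dotZl slack_dot // mulrN.
have lnn t i : t \in facets_at v -> 0 <= l i * y t (p i).
  by move=> tv; rewrite mulr_ge0 // (slack_ge0 tv) //; apply: conv_pt.
have [i li] : exists i, l i * y s (p i) != 0.
  apply: contrapT => /forallNP H; have := dus s sv; rewrite eqxx big1 => [/eqP|i _].
    by rewrite oner_eq0.
  by apply/eqP; apply: contra_notT (H i).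
move: li; rewrite mulf_eq0 negb_or => /andP[li yi].
exists i; first by rewrite lt0r yi (slack_ge0 sv) //; apply: conv_pt.
move=> t tv ts; have := dus t tv; rewrite eq_sym (negPf ts) => /esym S0.
have /eqP := psumr_eq0P (fun i _ => lnn t i tv) S0 (i := i) isT.
by rewrite mulf_eq0 (negPf li) => /eqP.
Qed.
End At.

(** * Faces and edges at the vertices *)

Variable d : nat.
Hypothesis dimP : has_dim P d.
Hypothesis simpleP : forall v, is_vertex P v ->
  (card_eq [set F | is_facet P F /\ F v] (`I_d))%classic.

Lemma vertex_in v : is_vertex P v -> P v.
Proof. by move=> vP; apply: face_sub vP (erefl v). Qed.

Lemma vertex_coords v : is_vertex P v -> exists u : label -> 'rV[R]_n,
  (forall x, P x -> x - v = \sum_(s in facets_at v) y s x *: u s) /\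
  forall s, s \in facets_at v -> exists2 i, 0 < y s (p i) &
    forall t, t \in facets_at v -> t != s -> y t (p i) = 0.
Proof. by move=> vP; apply: vertex_coord vP dimP (simpleP vP). Qed.

Definition face_of A : set 'rV[R]_n :=
  [set x | P x /\ forall s, s \in A -> y s x = 0]%classic.

Lemma face_of_face v A : A \subset facets_at v -> is_face P (face_of A).
Proof.
move/fintype.subsetP => sA.
have E x : \sum_(s in A) y s x = \sum_(s in A) (ineq s).2 - dot x (\sum_(s in A) (ineq s).1).
  by rewrite dot_sumr -sumrB.
have nn x : P x -> forall s, s \in A -> 0 <= y s x.
  by move=> Px s /sA sv; apply: (slack_ge0 sv).
apply: (@is_face_intro _ _ _ p _ (\sum_(s in A) (ineq s).1) (\sum_(s in A) (ineq s).2)) => [i|x].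
  by rewrite -subr_ge0 -E; apply: sumr_ge0; apply: nn; apply: conv_pt.
split=> -[Px H]; split=> //.
  by apply/esym/eqP; rewrite -subr_eq0 -E big1.
have S0 : \sum_(s in A) y s x = 0 by rewrite E H subrr.
by move=> s; apply: (psumr_eq0P (nn x Px) S0).
Qed.

Lemma face_of_vertex v w A : A \subset facets_at v -> is_vertex P w ->
  face_of A w <-> A \subset facets_at w.
Proof.
move/fintype.subsetP => sA wP; have Pw := vertex_in wP; split.
  case=> _ H; apply/fintype.subsetP => s sA'; apply/(slack_eq0 (sA s sA') Pw).
  exact: H.
move/fintype.subsetP=> sAw; split=> // s sA'.
by apply/(slack_eq0 (sA s sA') Pw); apply: sAw.
Qed.

(** In the coordinates at [v], a functional that is maximal at [v] has
    coefficients of one sign; the face it exposes is cut out by the coordinates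
    with nonzero coefficient. *)
Lemma face_at F v : is_face P F -> is_vertex P v -> F v ->
  exists2 A : {set label}, A \subset facets_at v & F = face_of A.
Proof.
move=> fF vP Fv; have [u [uE up]] := vertex_coords vP.
case/is_faceP: (fF) => c [b [cb FE]].
have vc : dot v c = b by have [] := (FE v).1 Fv.
have E x : P x -> b - dot x c = \sum_(s in facets_at v) y s x * - dot (u s) c.
  move=> Px; rewrite -vc -opprB -dotBl uE // dot_suml -sumrN; apply: eq_bigr => s _.
  by rewrite dotZl mulrN.
have g0 s : s \in facets_at v -> 0 <= - dot (u s) c.
  move=> sv; have [i yi yt] := up s sv.
  have := cb i; rewrite -subr_ge0 E; last exact: conv_pt.
  rewrite (bigD1 s) //= big1 => [|t /andP[tv ts]]; last by rewrite yt ?mul0r.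
  by rewrite addr0 pmulr_rge0.
exists [set s in facets_at v | dot (u s) c != 0]%SET.
  by apply/fintype.subsetP => s; rewrite inE => /andP[].
apply/seteqP; split=> x.
  move=> Fx; have [Px xc] := (FE x).1 Fx; split=> // s.
  rewrite inE => /andP[sv sc].
  have nn t : t \in facets_at v -> 0 <= y t x * - dot (u t) c.
    by move=> tv; rewrite mulr_ge0 ?g0 // (slack_ge0 tv).
  have S0 : \sum_(s in facets_at v) y s x * - dot (u s) c = 0 by rewrite -E // xc subrr.
  have /eqP := psumr_eq0P nn S0 sv.
  by rewrite mulf_eq0 oppr_eq0 (negPf sc) orbF => /eqP.
case=> Px H; apply/FE; split=> //; apply/esym/eqP; rewrite -subr_eq0 E //; apply/eqP.
apply: big1 => s sv; have [->|sc] := eqVneq (dot (u s) c) 0; first by rewrite oppr0 mulr0.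
by rewrite H ?mul0r // inE sv.
Qed.

(** The edge points of [vertex_coord] tell the sets of facets apart. *)
Lemma face_of_sub v A B : is_vertex P v -> A \subset facets_at v -> B \subset facets_at v ->
  (face_of A `<=` face_of B)%classic <-> B \subset A.
Proof.
move=> vP sA sB; split; last first.
  by move/fintype.subsetP=> sBA x [Px H]; split=> // s /sBA; apply: H.
move=> H; apply/fintype.subsetP => s sB'; apply: contrapT => /negP sA'.
have [u [_ up]] := vertex_coords vP.
have [i yi yt] := up s (fintype.subsetP sB s sB').
have [_ /(_ s sB') E] : face_of B (p i).
  apply: H; split=> [|t tA]; first exact: conv_pt.
  by apply: yt; [apply: (fintype.subsetP sA)|apply: contraNneq sA' => <-].
by rewrite E ltxx in yi.
Qed.

Lemma face_of_facets_at v : is_vertex P v -> face_of (facets_at v) = [set v]%classic.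
Proof.
move=> vP; have [u [uE _]] := vertex_coords vP; apply/seteqP; split=> x /=.
  case=> Px H; apply/eqP; rewrite -subr_eq0 uE //; apply/eqP.
  by apply: big1 => s sv; rewrite H ?scale0r.
by move=> ->; apply/(face_of_vertex (subxx _) vP).
Qed.

Lemma facets_at_inj v w : is_vertex P v -> is_vertex P w -> facets_at v \subset facets_at w -> v = w.
Proof.
by move=> vP wP /(face_of_vertex (subxx _) wP); rewrite face_of_facets_at // => /= ->.
Qed.

Lemma card_facets v : is_vertex P v -> #|facets_at v| = d.
Proof. by move=> vP; apply: card_facets_at (simpleP vP). Qed.

Lemma edge_vertex v r : is_vertex P v -> r \in facets_at v -> exists w,
  [/\ is_vertex P w, 0 < y r w, facets_at v :\ r \subset facets_at w &
      forall x, face_of (facets_at v :\ r) x -> y r x <= y r w].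
Proof.
move=> vP rv; have [u [_ up]] := vertex_coords vP.
have [i yi yt] := up r rv.
have fE : is_face P (face_of (facets_at v :\ r)) := face_of_face (subsetDl _ _).
have Ei : face_of (facets_at v :\ r) (p i).
  by split=> [|t]; [apply: conv_pt|rewrite in_setD1 => /andP[tr tv]; apply: yt].
have [k [Ek kP kmax]] := face_vertex (- (ineq r).1) fE Ei.
have yle x : face_of (facets_at v :\ r) x -> y r x <= y r (p k).
  by move/kmax; rewrite !dotNr /slack; lra.
exists (p k); split=> //; first exact: lt_le_trans yi (yle _ Ei).
by apply/(face_of_vertex (subsetDl _ _) kP).
Qed.

Lemma edge_dir v r u w c : is_vertex P v -> r \in facets_at v ->
    (forall x, P x -> x - v = \sum_(s in facets_at v) y s x *: u s) ->
    face_of (facets_at v :\ r) w ->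
  dot (w - v) c = y r w * dot (u r) c.
Proof.
move=> vP rv uE [Pw H]; rewrite uE // (bigD1 r) //= big1 => [|t /andP[tv tr]].
  by rewrite addr0 dotZl.
by rewrite H ?scale0r // in_setD1 tr.
Qed.

(** Along an edge only one coordinate varies and it is nonnegative, so a
    functional keeps its sign there. *)
Lemma edge_sign v r w w' c : is_vertex P v -> r \in facets_at v ->
    is_vertex P w -> is_vertex P w' ->
    facets_at v :\ r \subset facets_at w -> facets_at v :\ r \subset facets_at w' ->
  dot (w - v) c < 0 -> 0 < dot (w' - v) c -> False.
Proof.
move=> vP rv wP wP' /(face_of_vertex (subsetDl _ _) wP) Ew.
move=> /(face_of_vertex (subsetDl _ _) wP') Ew'.
have [u [uE _]] := vertex_coords vP.
rewrite (edge_dir c vP rv uE Ew) (edge_dir c vP rv uE Ew').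
have y1 := slack_ge0 rv (vertex_in wP).
have y2 := slack_ge0 rv (vertex_in wP').
move=> h1 h2; have u0 : dot (u r) c < 0.
  by rewrite ltNge; apply: contraTN h1 => u0; rewrite -leNgt mulr_ge0.
by move: h2; rewrite ltNge nmulr_lle0 // y2.
Qed.

(** If [c] decreases from [v] to [w], one of the terms of [dot (w - v) c] in the
    coordinates at [v] is negative. Its coordinate is positive at [w], so it
    belongs to an edge inside every face through [v] and [w], and [c]
    decreases along that edge. *)
Lemma shell_dir v w A c : is_vertex P v -> is_vertex P w ->
    A \subset facets_at v -> A \subset facets_at w -> dot (w - v) c < 0 ->
  exists r, [/\ r \in facets_at v, r \notin A & exists w',
    [/\ is_vertex P w', dot (w' - v) c < 0 & facets_at v :\ r \subset facets_at w']].
Proof.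
move=> vP wP sAv sAw; have [u [uE up]] := vertex_coords vP.
rewrite uE ?dot_suml => [wc|]; last exact: vertex_in.
have [r [rv rc]] : exists r, r \in facets_at v /\ y r w * dot (u r) c < 0.
  apply: contrapT => /forallNP H; move: wc; rewrite ltNge => /negP; apply.
  apply: sumr_ge0 => s sv; rewrite dotZl leNgt; apply/negP => sc.
  by apply: (H s).
have yw0 := slack_ge0 rv (vertex_in wP).
have yw : y r w != 0 by apply: contraTneq rc => ->; rewrite mul0r ltxx.
have rc0 : dot (u r) c < 0.
  by rewrite ltNge; apply: contraTN rc => u0; rewrite -leNgt mulr_ge0.
exists r; split=> //.
  by apply: contra_neqN yw => /(fintype.subsetP sAw) /(slack_eq0 rv (vertex_in wP)).
have [w' [wP' yw' sw _]] := edge_vertex vP rv.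
exists w'; split=> //.
have /(face_of_vertex (subsetDl _ _) wP') Ew := sw.
by rewrite (edge_dir c vP rv uE Ew) pmulr_rlt0.
Qed.
(** * A sweep order of the vertices *)

Hypothesis d_gt0 : (0 < d)%N.

Lemma vertex_ex : exists v, is_vertex P v.
Proof.
have [x Px] : exists x, P x.
  have [x0 [U [_ E]]] := dimP.
  have : affine_hull P x0 by rewrite E; exists 0; rewrite ?addr0 //= mem0v.
  case=> -[|k] [q [a [qP a1 _]]]; last by exists (q ord0).
  by move: a1; rewrite big_ord0 => /esym/eqP; rewrite oner_eq0.
have fP : is_face P P.
  apply: (@is_face_intro _ _ _ p _ 0 0) => [i|z]; rewrite /dot mulmx0 mxE //.
  by split=> [|[]].
by have [k [_ kP _]] := face_vertex 0 fP Px; exists (p k).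
Qed.

(** Let the denominator be the sum of the slacks that vanish on an edge [p0 q0],
    plus a small constant, and let the numerator change sign along the edge.
    The ratio is very negative at [p0], very positive at [q0], and bounded at
    the vertices off the edge. *)
Lemma extremal_edge : exists p0 q0 r (a b : 'cV[R]_n * R), [/\
  [/\ is_vertex P p0, is_vertex P q0, p0 != q0, r \in facets_at p0 &
      facets_at p0 :\ r \subset facets_at q0],
  forall w, is_vertex P w -> 0 < slack b w,
  forall w, is_vertex P w -> w != p0 -> slack a p0 * slack b w < slack a w * slack b p0 &
  forall w, is_vertex P w -> w != q0 -> slack a w * slack b q0 < slack a q0 * slack b w].
Proof.
have [p0 p0P] := vertex_ex.
have [r rp0] : exists r, r \in facets_at p0.
  by apply/set0Pn; rewrite -card_gt0 (card_facets p0P).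
have [q0 [q0P yq0 sq0 qmax]] := edge_vertex p0P rp0.
pose E := face_of (facets_at p0 :\ r).
have [u [uE _]] := vertex_coords p0P.
pose b0 w := \sum_(s in facets_at p0 :\ r) y s w.
have b0_ge0 w : is_vertex P w -> 0 <= b0 w.
  move=> wP; apply: sumr_ge0 => s; rewrite in_setD1 => /andP[_ sp].
  by apply: (slack_ge0 sp); apply: vertex_in.
have b0_E w : is_vertex P w -> b0 w = 0 -> E w.
  move=> wP; have Pw := vertex_in wP; move=> S0; split=> //.
  have nn s : s \in facets_at p0 :\ r -> 0 <= y s w.
    by rewrite in_setD1 => /andP[_ sp]; apply: (slack_ge0 sp).
  exact: (psumr_eq0P nn S0).
have b0_0 w : E w -> b0 w = 0 by case=> _ H; apply: big1.
have E_eq w w' : E w -> E w' -> y r w = y r w' -> w = w'.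
  move=> Ew Ew' yE; apply: (addIr (- p0)).
  rewrite (uE _ Ew.1) (uE _ Ew'.1) (bigD1 r) //= [RHS](bigD1 r) //= yE; congr (_ + _).
  have H z : E z -> \sum_(s in facets_at p0 | s != r) y s z *: u s = 0.
    by case=> _ H; apply: big1 => s /andP[sp sr]; rewrite H ?scale0r // in_setD1 sr.
  by rewrite !H.
have Ep0 : E p0 by apply/(face_of_vertex (subsetDl _ _) p0P); apply: subsetDl.
have Eq0 : E q0 by apply/(face_of_vertex (subsetDl _ _) q0P).
have yp0 : y r p0 = 0 by apply: (slack_at).
set eta := y r q0 in yq0 qmax.
pose s := [seq p i | i <- enum 'I_m & 0 < b0 (p i)].
have [w|e e0 es] := @small_pos _ _ s (fun w => eta / 2 * b0 w) (fun w => y r w - eta).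
  case/mapP=> i; rewrite mem_filter => /andP[bi _] ->.
  by rewrite mulr_gt0 // divr_gt0.
pose a : 'cV[R]_n * R := ((ineq r).1, (ineq r).2 - eta / 2).
pose b : 'cV[R]_n * R :=
  (\sum_(s in facets_at p0 :\ r) (ineq s).1,
   \sum_(s in facets_at p0 :\ r) (ineq s).2 + e).
have aE w : slack a w = y r w - eta / 2 by rewrite /slack /a /=; ring.
have bE w : slack b w = b0 w + e.
  by rewrite /slack /b /b0 /= /slack sumrB dot_sumr; ring.
exists p0, q0, r, a, b; split.
- split=> //; apply: contraTneq yq0 => E'; by rewrite /eta -E' yp0 ltxx.
- by move=> w wP; rewrite bE; have := b0_ge0 w wP; lra.
- move=> w wP ne; rewrite !aE !bE yp0 (b0_0 p0 Ep0).
  have yw := slack_ge0 rp0 (vertex_in wP); have bw := b0_ge0 w wP.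
  have [yw0|yw0] := eqVneq (y r w) 0.
    have bw0 : 0 < b0 w.
      rewrite lt0r bw andbT; apply: contraNneq ne => /(b0_E w wP) Ew.
      by apply/eqP; apply: E_eq => //; rewrite yw0 yp0.
    by rewrite yw0; have := mulr_gt0 yq0 bw0; nra.
  have yw1 : 0 < y r w by rewrite lt0r yw0.
  by have := mulr_gt0 yw1 e0; have := mulr_ge0 (ltW yq0) bw; nra.
- move=> w wP ne; rewrite !aE !bE (b0_0 q0 Eq0) -/eta.
  have bw := b0_ge0 w wP; have [bw0|bw0] := eqVneq (b0 w) 0.
    have Ew := b0_E w wP bw0; rewrite bw0.
    have : y r w < eta.
      rewrite lt_neqAle qmax // andbT; apply: contraNneq ne => yE.
      by apply/eqP; apply: E_eq.
    by rewrite -subr_gt0 => h; have := mulr_gt0 h e0; nra.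
  have bw1 : 0 < b0 w by rewrite lt0r bw0.
  have [k wk] := vertex_pt wP.
  have ws : w \in s by rewrite wk map_f // mem_filter -wk bw1 mem_enum.
  have := es w ws; have := ler_norm (y r w - eta); set N := `|_| => h1 h2.
  have : e * (y r w - eta) <= e * N by rewrite ler_wpM2l // ltW.
  by nra.
Qed.

(** The vertices are sorted by the ratio [slack a / slack b]. Its comparison
    with the value at [v] is the sign of the affine function
    [slack a - key v * slack b], which vanishes at [v]; [c v] is the linear part.
    In this form the order satisfies the hypotheses of [shell_dir] and
    [edge_sign]. *)
Theorem vertex_order : exists (vs : seq 'rV[R]_n) (c : 'rV[R]_n -> 'cV[R]_n) (r : label),
  [/\ forall v, v \in vs <-> is_vertex P v,
      forall i j, (i < j < size vs)%N ->
        0 < dot (vs`_j - vs`_i) (c vs`_i) /\ dot (vs`_i - vs`_j) (c vs`_j) < 0,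
      (1 < size vs)%N,
      r \in facets_at vs`_0 &
      facets_at vs`_0 :\ r \subset facets_at vs`_(size vs).-1].
Proof.
have [p0 [q0 [r [a0 [b [[p0P q0P pq rp0 sub] bV ap aq]]]]]] := extremal_edge.
pose V := undup [seq p i | i <- enum 'I_m & `[< is_vertex P (p i) >]].
have mV v : v \in V <-> is_vertex P v.
  rewrite mem_undup; split=> [/mapP[i]|vP].
    by rewrite mem_filter => /andP[/asboolP ? _] ->.
  have [k vk] := vertex_pt vP; apply/mapP; exists k => //.
  by rewrite mem_filter mem_enum andbT; apply/asboolP; rewrite -vk.
have [w /mV wP|w /mV wP|w /mV wP|a [ap' aq' ainj]] :=
    @generic_ratio R n V a0 b p0 q0; [exact: bV|exact: ap|exact: aq|].
pose key w := slack a w / slack b w.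
have bV' w : w \in V -> 0 < slack b w by move/mV/bV.
have p0V : p0 \in V by apply/mV.
have q0V : q0 \in V by apply/mV.
have keyp w : w \in V -> w != p0 -> key p0 < key w.
  move=> wV ne; rewrite /key ltr_pdivrMr ?bV' // mulrAC ltr_pdivlMr ?bV' //.
  exact: ap'.
have keyq w : w \in V -> w != q0 -> key w < key q0.
  move=> wV ne; rewrite /key ltr_pdivrMr ?bV' // mulrAC ltr_pdivlMr ?bV' //.
  exact: aq'.
have keyI : {in V &, injective key}.
  move=> w w' wV wV' kE; apply/eqP; apply: contraT => ne.
  have /negP[] := ainj w w' wV wV' ne.
  rewrite -eqr_div; [exact/eqP|exact: lt0r_neq0 (bV' _ _)|exact: lt0r_neq0 (bV' _ _)].
pose le_key := relpre key <=%O.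
pose vs := sort le_key V.
have mvs w : (w \in vs) = (w \in V) by rewrite mem_sort.
have uvs : uniq vs by rewrite sort_uniq undup_uniq.
have svs : sorted le_key vs by apply: sort_sorted => w w'; apply: le_total.
have le_nth i j : (i <= j < size vs)%N -> key vs`_i <= key vs`_j.
  case/andP=> ij js.
  have tr : transitive le_key by move=> ? ? ?; apply: le_trans.
  apply: (sorted_leq_nth tr _ 0 svs) => //; first by move=> w; apply: lexx.
  by rewrite inE (leq_ltn_trans ij).
have lt_nth i j : (i < j < size vs)%N -> key vs`_i < key vs`_j.
  move=> /andP[ij js]; rewrite lt_neqAle le_nth ?(ltnW ij) // andbT.
  have is' := ltn_trans ij js.
  apply: contraTneq ij => /keyI/eqP; rewrite -!mvs !mem_nth // => /(_ isT isT).
  by rewrite nth_uniq // => /eqP ->; rewrite ltnn.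
pose c v := - (a.1 - key v *: b.1).
have cE v w : w \in V -> v \in V -> dot (w - v) (c v) = slack b w * (key w - key v).
  move=> wV vV; have bw := lt0r_neq0 (bV' w wV); have bv := lt0r_neq0 (bV' v vV).
  have -> : dot (w - v) (c v) = (slack a w - slack a v) - key v * (slack b w - slack b v).
    by rewrite dotNr dotBr dotZr !slackB; ring.
  by rewrite /key; field; rewrite bw bv.
have inV i : (i < size vs)%N -> vs`_i \in V by move=> ?; rewrite -mvs mem_nth.
have size_gt1 : (1 < size vs)%N.
  rewrite size_sort; have : {subset [:: p0; q0] <= V}.
    by move=> z; rewrite !inE => /orP[]/eqP ->.
  by move=> /uniq_leq_size H; apply: H; rewrite /= inE pq.
have s0 : (0 < size vs)%N by apply: ltnW.
have s1 : ((size vs).-1 < size vs)%N by rewrite prednK.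
have hd : vs`_0 = p0.
  apply/eqP; apply: contraT => ne; have := keyp _ (inV 0%N s0) ne; rewrite ltNge => /negP[].
  have := p0V; rewrite -mvs => pvs.
  by rewrite -[p0](nth_index 0 pvs); apply: le_nth; rewrite index_mem.
have lst : vs`_(size vs).-1 = q0.
  apply/eqP; apply: contraT => ne; have := keyq _ (inV _ s1) ne; rewrite ltNge => /negP[].
  have := q0V; rewrite -mvs => qvs.
  rewrite -[q0](nth_index 0 qvs); apply: le_nth; rewrite s1 andbT -ltnS prednK //.
  by rewrite index_mem.
exists vs, c, r; split=> //.
- by move=> v; rewrite mvs.
- move=> i j ij; have k := lt_nth i j ij; case/andP: ij => ij js.
  have is' := ltn_trans ij js.
  rewrite !cE ?inV //; split; first by rewrite mulr_gt0 ?bV' ?inV // subr_gt0.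
  by rewrite pmulr_rlt0 ?bV' ?inV // subr_lt0.
- by rewrite hd.
- by rewrite hd lst.
Qed.
(** * The face lattice *)

Lemma empty_face : `[< is_face P set0 >].
Proof.
apply/asboolP; apply: (@is_face_intro _ _ _ p set0 0 1) => [i|x].
  by rewrite /dot mulmx0 mxE.
by rewrite /dot mulmx0 mxE; split=> // -[_ /eqP]; rewrite eq_sym oner_eq0.
Qed.

Definition empty_elt : face_lattice P := Face empty_face.
(** Meaningful only for sets of facets with a common vertex, which is all that
    [val_elt_of] covers. *)
Definition elt_of A : face_lattice P := insubd empty_elt (face_of A).

Lemma val_elt_of v A : A \subset facets_at v -> val (elt_of A) = face_of A.
Proof. by move=> sA; rewrite insubdK //; apply/asboolP; apply: (face_of_face sA). Qed.

Lemma lt_face_sub (F G : face_lattice P) :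
  (F < G)%O -> (val F `<=` val G)%classic /\ val F <> val G.
Proof.
rewrite lt_neqAle => /andP[ne]; rewrite face_lattice_leE; split=> //.
by move/val_inj => E; rewrite E eqxx in ne.
Qed.

Lemma sub_face_lt (F G : face_lattice P) :
  (val F `<=` val G)%classic -> val F <> val G -> (F < G)%O.
Proof.
move=> s ne; rewrite lt_neqAle; apply/andP; split; last by rewrite face_lattice_leE.
by apply/eqP => E; apply: ne; rewrite E.
Qed.

(** A face between two faces through [v] is itself cut out by a set of facets at
    [v], and no set lies strictly between [A] and [x |: A]. *)
Lemma elt_of_covers v A (x : label) : is_vertex P v -> x \notin A -> x |: A \subset facets_at v ->
  covers (elt_of (x |: A)) (elt_of A).
Proof.
move=> vP xA sB; have sA : A \subset facets_at v := fintype.subset_trans (finset.subsetUr _ _) sB.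
have sub (C D : {set label}) : C \subset facets_at v -> D \subset facets_at v ->
    (face_of C `<=` face_of D)%classic <-> D \subset C.
  exact (@face_of_sub v C D vP).
split.
  apply: sub_face_lt; rewrite !(@val_elt_of v) //; first by apply/sub => //; apply: finset.subsetUr.
  move=> E; have : x |: A \subset A by apply/sub => //; rewrite E.
  by move/fintype.subsetP/(_ x); rewrite setU11 (negPf xA) => /(_ isT).
case=> G [/lt_face_sub[s1 n1] /lt_face_sub[s2 n2]].
rewrite !(@val_elt_of v) // in s1 n1 s2 n2.
have Gv : val G v by apply: s1; apply/(face_of_vertex sB vP).
have fG : is_face P (val G) by apply/asboolP; apply: (valP G).
have [C sC CE] := face_at fG vP Gv.
rewrite CE in s1 n1 s2 n2.
have CB : C \subset x |: A by apply/sub.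
have AC : A \subset C by apply/sub.
have [xC|xC] := boolP (x \in C).
  apply: n1; congr face_of; apply/eqP.
  by rewrite finset.eqEsubset CB finset.subUset finset.sub1set xC AC.
apply: n2; congr face_of; apply/eqP; rewrite finset.eqEsubset AC andbT.
apply/fintype.subsetP => z zC; move: (fintype.subsetP CB z zC).
by rewrite in_setU1 => /predU1P[E|//]; rewrite -E zC in xC.
Qed.

Lemma empty_elt_covers v : is_vertex P v -> covers empty_elt (elt_of (facets_at v)).
Proof.
move=> vP; have vE : val (elt_of (facets_at v)) = [set v]%classic.
  by rewrite (val_elt_of (subxx _)) (face_of_facets_at vP).
split.
  apply: sub_face_lt; rewrite vE //=.
  by move=> E; have : [set v]%classic v by []; rewrite -E.
case=> G [/lt_face_sub[_ n1] /lt_face_sub[s2 n2]]; rewrite vE in s2 n2.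
apply: n2; apply/seteqP; split=> // x ->.
have [z Gz] : exists z, val G z.
  by apply: contrapT => /forallNP H; apply: n1; apply/seteqP; split=> // z /H.
by have /= <- := s2 z Gz.
Qed.

Lemma elt_of_adj A B : (exists2 v, is_vertex P v & A \subset facets_at v) ->
  (exists2 v, is_vertex P v & B \subset facets_at v) ->
  set_adj A B -> cover_graph (face_lattice P) (elt_of A) (elt_of B).
Proof.
move=> [v vP sA] [w wP sB] /existsP[x /orP[]/andP[xA /eqP E]]; apply/asboolP.
  by right; rewrite E; apply: (elt_of_covers wP) => //; rewrite -E.
by left; rewrite E; apply: (elt_of_covers vP) => //; rewrite -E.
Qed.

(** Both faces contain [v], so both sets of facets are sets of facets at [v]. *)
Lemma elt_of_inj A B v w : is_vertex P v -> is_vertex P w ->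
  A \subset facets_at v -> B \subset facets_at w -> elt_of A = elt_of B -> A = B.
Proof.
move=> vP wP sA sB /(congr1 val); rewrite (val_elt_of sA) (val_elt_of sB) => E.
have sBv : B \subset facets_at v.
  by apply/(face_of_vertex sB vP); rewrite -E; apply/(face_of_vertex sA vP).
apply/eqP; rewrite finset.eqEsubset.
by apply/andP; split; apply/(face_of_sub vP) => //; rewrite E.
Qed.

(** The sets of facets at the vertices, taken in [vertex_order], satisfy the
    hypotheses of [shelling_path]. *)
Lemma facet_set_path : exists q : seq {set label}, [/\ uniq q, sorted (@set_adj _) q,
  (1 < size q)%N,
  exists v w, [/\ is_vertex P v, is_vertex P w &
    forall z, head z q = facets_at v /\ last z q = facets_at w] &
  forall A, A \in q <-> exists2 v, is_vertex P v & A \subset facets_at v].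
Proof.
have [vs [c [r [mvs vsc size_gt1 r0 sub]]]] := vertex_order.
set M := size vs in vsc size_gt1 sub.
pose F i := facets_at vs`_i.
have vP i : (i < M)%N -> is_vertex P vs`_i by move=> iM; apply/mvs; rewrite mem_nth.
have vsE w : is_vertex P w -> exists2 k, (k < M)%N & w = vs`_k.
  by move/mvs => wvs; exists (index w vs); rewrite ?index_mem // nth_index.
have hcard i : (i < M)%N -> #|F i| = d by move=> iM; rewrite /F (card_facets (vP i iM)).
have before i k : (i < M)%N -> (k < M)%N -> dot (vs`_k - vs`_i) (c vs`_i) < 0 -> (k < i)%N.
  move=> iM kM; have [//|ik|->] := ltngtP k i; last by rewrite subrr dot0l ltxx.
  by have [] := vsc i k; rewrite ?ik // => h _ h'; have := lt_trans h h'; rewrite ltxx.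
have after i k : (i < M)%N -> (k < M)%N -> 0 < dot (vs`_k - vs`_i) (c vs`_i) -> (i < k)%N.
  move=> iM kM; have [ki|//|->] := ltngtP k i; last by rewrite subrr dot0l ltxx.
  by have [] := vsc k i; rewrite ?ki // => _ h h'; have := lt_trans h h'; rewrite ltxx.
have h_earlier i j A : (j < i < M)%N -> A \subset F i -> A \subset F j ->
    exists r, [/\ r \in F i, r \notin A & earlier F M i r].
  case/andP=> ji iM sAi sAj; have jM := ltn_trans ji iM.
  have [_ neg] : _ /\ _ := vsc j i (introT andP (conj ji iM)).
  have [s [si sA [w [wP wc sw]]]] := shell_dir (vP i iM) (vP j jM) sAi sAj neg.
  exists s; split=> //; apply/(earlierP _ _ iM).
  have [k kM wE] := vsE w wP; rewrite wE in wc sw.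
  by exists k => //; apply: before wc.
have h_later i j A : (i < j < M)%N -> A \subset F i -> A \subset F j ->
    exists r, [/\ r \in F i, r \notin A & later F M i r].
  case/andP=> ij jM sAi sAj; have iM := ltn_trans ij jM.
  have [pos _] : _ /\ _ := vsc i j (introT andP (conj ij jM)).
  have neg : dot (vs`_j - vs`_i) (- c vs`_i) < 0 by rewrite dotNr oppr_lt0.
  have [s [si sA [w [wP wc sw]]]] := shell_dir (vP i iM) (vP j jM) sAi sAj neg.
  exists s; split=> //; apply/laterP.
  have [k kM wE] := vsE w wP; rewrite wE in wc sw.
  by exists k => //; rewrite kM andbT; apply: after => //; rewrite -oppr_lt0 -dotNr.
have h_N i s : (i < M)%N -> s \in F i -> earlier F M i s = ~~ later F M i s.
  move=> iM si; apply/idP/idP => [/(earlierP _ _ iM)[k ki sk]|].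
    apply/laterP => -[l /andP[il lM] sl2].
    have kM := ltn_trans ki iM.
    have [_ neg] : _ /\ _ := vsc k i (introT andP (conj ki iM)).
    have [pos _] : _ /\ _ := vsc i l (introT andP (conj il lM)).
    exact: (edge_sign (vP i iM) si (vP k kM) (vP l lM) sk sl2 neg pos).
  have [w [wP yw sw _]] := edge_vertex (vP i iM) si.
  have [k kM wE] := vsE w wP; rewrite wE in yw sw.
  have [ki|ik|ki] := ltngtP k i.
  - by move=> _; apply/(earlierP _ _ iM); exists k.
  - by case/laterP; exists k; rewrite ?ik.
  - by move: yw; rewrite ki (slack_at (vP i iM) si) ltxx.
have [q [uq sq hl mq]] := shelling_path size_gt1 hcard h_earlier h_later h_N r0 sub.
have M0 : (0 < M)%N by apply: ltnW.
have M1 : (M.-1 < M)%N by rewrite prednK.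
have M01 : (0 < M.-1)%N by rewrite -ltnS prednK.
exists q; split=> //.
- have : {subset [:: F 0%N; F M.-1] <= q}.
    by move=> A; rewrite !inE => /orP[]/eqP->; apply/mq; [exists 0%N|exists M.-1].
  move/uniq_leq_size; apply; rewrite /= inE andbT; apply/eqP => E.
  have [pos _] : _ /\ _ := vsc 0%N M.-1 (introT andP (conj M01 M1)).
  have vE : vs`_0 = vs`_M.-1.
    by apply: (facets_at_inj (vP _ M0) (vP _ M1)); rewrite -/(F _) E.
  by move: pos; rewrite -vE subrr dot0l ltxx.
- by exists vs`_0, vs`_M.-1; split; [exact: vP|exact: vP|].
- move=> A; rewrite mq; split=> [[i iM sA]|[v /vsE[k kM ->] sA]]; last by exists k.
  by exists vs`_i => //; apply: vP.
Qed.

(** The path of [facet_set_path] runs between two vertices, and the empty face,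
    which both of them cover, closes it. *)
Lemma lattice_hamiltonian : hamiltonian (cover_graph (face_lattice P)).
Proof.
have [q [uq sq size_q [v0 [v1 [v0P v1P hl]]] mq]] := facet_set_path.
case: q uq sq size_q hl mq => // A0 q uq sq size_q hl mq.
have [A0E qE] := hl A0; rewrite /= in A0E qE.
exists (rcons (map elt_of (A0 :: q)) empty_elt); split.
- by rewrite size_rcons size_map.
- apply/andP; split.
    rewrite map_cons rcons_cons /cycle rcons_path last_rcons.
    apply/andP; split.
      rewrite rcons_path last_map qE path_map; apply/andP; split; last first.
        by apply/asboolP; right; apply: empty_elt_covers.
      apply: (@sub_in_path _ [pred A | A \in A0 :: q] (@set_adj _)) sq.
        by move=> A B /mq HA /mq HB; apply: elt_of_adj.
      by apply/allP.
    by apply/asboolP; left; rewrite A0E; apply: empty_elt_covers.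
  rewrite rcons_uniq map_inj_in_uniq ?uq ?andbT.
    apply/mapP => -[A /mq[v vP sA]] /(congr1 val); rewrite (val_elt_of sA) /= => E.
    have : face_of A v by apply/(face_of_vertex sA vP).
    by rewrite -E.
  by move=> A B /mq[v vP sA] /mq[w wP sB]; apply: (elt_of_inj vP wP sA sB).
- move=> G; rewrite mem_rcons inE.
  have fG : is_face P (val G) by apply/asboolP; apply: (valP G).
  have [[x Gx]|nG] := pselect (exists x, val G x); last first.
    apply/orP; left; apply/eqP/val_inj/seteqP; split=> // x Gx.
    by case: nG; exists x.
  have [k [Gk kP _]] := face_vertex 0 fG Gx.
  have [A sA GE] := face_at fG kP Gk.
  apply/orP; right; apply/mapP; exists A; first by apply/mq; exists (p k).
  by apply: val_inj; rewrite (val_elt_of sA).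
Qed.
End Vertex.

Theorem corollary3 (R : realType) (n d : nat) (P : set 'rV[R]_n)
  (simpleP : simple_polytope d P) (d_gt0 : (0 < d)%N) :
  hamiltonian (cover_graph (face_lattice P)).
Proof.
case: simpleP => -[m [p ->]] dimP simpleP.
have [ineq ineqP] := facet_slack p.
exact: (lattice_hamiltonian ineqP dimP simpleP d_gt0).
Qed.
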